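(* Let $d\ge 2$ and $n\ge 1$ be integers and let $x_1,\ldots,x_n\in\mathbb{R}^d$ be deterministic vectors, not all zero. Define $\sigma>0$ by $\frac{1}{n}\sum_{i=1}^n|x_i|^2=\sigma^2 d$. Suppose $A,B$ are constants such that $$\frac{1}{n}\sum_{i=1}^n\big|\sigma^{-2}|x_i|^2-d\big|\le A$$ and, for all $\theta\in\mathbb{S}^{d-1}$, $$\frac{1}{n}\sum_{i=1}^n\langle\theta,x_i\rangle^2\le B.$$ For $\theta\in\mathbb{S}^{d-1}$, let $\mu_n^\theta$ be the probability measure on $\mathbb{R}$ putting mass $\frac1n$ at each of the points $\langle\theta,x_1\rangle,\ldots,\langle\theta,x_n\rangle$. Fix a test function $f:\mathbb{R}\to\mathbb{R}$ with $\|f\|_{BL}:=\|f\|_\infty+\sup_{x\neq y}\frac{|f(x)-f(y)|}{|x-y|}\le 1$. Let $Z$ be a standard Gaussian random variable and let $\theta$ be distributed uniformly on $\mathbb{S}^{d-1}$. Then for every $$\epsilon>\max\left(\frac{2\pi\sqrt{B}}{\sqrt{d-1}},\frac{2(A+2)}{d-1}\right),$$ we have $$\mathbb{P}\left[\left|\int f(x)\,d\mu_n^\theta(x)-\mathbb{E} f(\sigma Z)\right|>\epsilon\right]\le\sqrt{\frac{\pi}{2}}\,e^{-\frac{(d-1)}{2^5B}\epsilon^2}.$$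
   Context: $\mathbb{S}^{d-1}$ denotes the unit sphere in $\mathbb{R}^d$, $\langle\cdot,\cdot\rangle$ the standard inner product, and ''uniformly'' refers to the normalized rotation-invariant surface measure on $\mathbb{S}^{d-1}$. *)

(* Defs.v *)
From HB Require Import structures.
From mathcomp Require Import all_boot all_order all_algebra.
From mathcomp Require Import all_classical all_reals all_analysis.
Set Implicit Arguments. Unset Strict Implicit. Unset Printing Implicit Defensive.
Import Order.TTheory GRing.Theory Num.Theory.
Import numFieldNormedType.Exports.
Local Open Scope classical_set_scope.
Local Open Scope ring_scope.

Definition dotv {R : realType} {d : nat} (u v : 'rV[R]_d) : R :=
  \sum_(i < d) u 0 i * v 0 i.

Definition enorm {R : realType} {d : nat} (v : 'rV[R]_d) : R :=
  Num.sqrt (dotv v v).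

Definition sphere (R : realType) (d : nat) : set 'rV[R]_d :=
  [set v | enorm v = 1].

Notation RdBorel R d := (g_sigma_algebraType (@open 'rV[R]_d)).

Definition is_rotation {R : realType} {d : nat} (Q : 'M[R]_d) : Prop :=
  Q *m Q^T = 1%:M /\ \det Q = 1.

(* P is the uniform distribution on S^{d-1}: a Borel probability measure on
   R^d concentrated on the sphere and invariant under all rotations
   (such a measure is unique: the normalized surface measure). *)
Definition uniform_on_sphere {R : realType} {d : nat}
    (P : probability (RdBorel R d) R) : Prop :=
  P (~` @sphere R d) = 0%E /\
  forall (Q : 'M[R]_d), is_rotation Q ->
    forall A : set (RdBorel R d), measurable A ->
      P ((fun x : 'rV[R]_d => x *m Q) @^-1` A) = P A.

(* bounded-Lipschitz norm ||f||_BL = ||f||_oo + Lip(f), in the extended reals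
   (it is +oo when f is unbounded or not Lipschitz) *)
Definition BL_norm {R : realType} (f : R -> R) : \bar R :=
  (ereal_sup [set (`|f x|)%:E | x in [set: R]] +
   ereal_sup [set (`|f xy.1 - f xy.2| / `|xy.1 - xy.2|)%:E
              | xy in [set xy : R * R | xy.1 != xy.2]])%E.

Definition empirical_integral {R : realType} {d n : nat}
    (x : 'I_n -> 'rV[R]_d) (theta : 'rV[R]_d) (f : R -> R) : R :=
  n%:R^-1 * \sum_(i < n) f (dotv theta (x i)).

Definition gauss_expect {R : realType} (f : R -> R) (sigma : R) : R :=
  Rintegral (normal_prob 0 1) [set: R] (fun z => f (sigma * z)).

(* Main.v *)
(* Let g solve the Gaussian Stein equation g'(w) - w g(w) = f(sigma w) - N with N = E f(sigma Z),
   so that F(theta) - N, with F(theta) = n^-1 sum_i f(<theta, x_i>), is the mean over i of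
   g'(W_i) - W_i g(W_i) with W_i = <theta, x_i> / sigma. Rotation invariance gives the integration
   by parts (d - 1) E[W_i Psi] = E <grad Psi, x_i^tan> / sigma on the sphere, where x_i^tan is the
   tangential part of x_i at theta. With Psi = g(W_i) exp(s (F - N)) this bounds the derivative of
   m(s) = E exp(s (F - N)) by (alpha + beta s) m(s): alpha comes from |g'| <= 2 sup|f| together with
   the thin-shell bound A, and beta from |g| <= 3 sigma Lip(f) together with the operator bound B.
   Gronwall's and Markov's inequalities conclude for f of class C^1; a Lipschitz f is approximated
   by the difference quotients of its primitive. *)

Require Import Defs.
From HB Require Import structures.
From mathcomp Require Import all_boot all_order all_algebra.
From mathcomp Require Import all_classical all_reals all_analysis.
From mathcomp Require Import measurable_realfun.
From mathcomp Require Import ring lra.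
Import Order.TTheory GRing.Theory Num.Theory.
Import numFieldNormedType.Exports.
Local Open Scope classical_set_scope.
Local Open Scope ring_scope.

(** The constants come from a split a + b = 1, where a bounds sup|f| and b is a Lipschitz constant.
    Put D = d - 1 and q = sqrt(B / D). Here alpha = (2 a (A + 2) + (9/4) b sqrt B) / D. The
    assumption eps > 2 (A + 2) / D charges the first term to a eps, and at least b (eps - (9/4) q)
    of eps remains. Since beta = 3 b^2 B / D, optimizing over s cancels b and leaves the one-sided
    bound exp(- D (eps - (9/4) q)^2 / (6 B)). For eps / q > 2 pi the gap between 1/6 and 1/32
    absorbs the shift 9/4 and the second side. The obstacle is the unbounded factor W_i^2 - 1 that
    integration by parts puts next to g'(W_i). With sup|g'| alone it would bring in B / sigma^2,
    which no threshold controls. The decay of g', of order sigma Lip(f) / |w|, reduces it to a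
    constant plus (9/4) b |<theta, x_i>|, whose mean is at most sqrt B up to that factor. *)

Section real_continuity.
Context {T : topologicalType} {R : realType}.
Implicit Types f g : T -> R.

(** * Continuity of real-valued functions *)

Lemma continuous_addR f g : continuous f -> continuous g ->
  continuous (fun x => f x + g x).
Proof. by move=> cf cg x; apply: continuousD; [exact: cf|exact: cg]. Qed.

Lemma continuous_oppR f : continuous f -> continuous (fun x => - f x).
Proof. by move=> cf x; apply: continuousN; exact: cf. Qed.

Lemma continuous_mulR f g : continuous f -> continuous g ->
  continuous (fun x => f x * g x).
Proof. by move=> cf cg x; apply: continuousM; [exact: cf|exact: cg]. Qed.

Lemma continuous_cstR (c : R) : continuous (fun _ : T => c).
Proof. by move=> x; exact: cvg_cst. Qed.

Lemma continuous_compR f (h : R -> R) : continuous f -> continuous h ->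
  continuous (fun x => h (f x)).
Proof. by move=> cf ch x; apply: continuous_comp; [exact: cf|exact: ch]. Qed.

Lemma continuous_sumR n (F : 'I_n -> T -> R) : (forall i, continuous (F i)) ->
  continuous (fun x => \sum_(i < n) F i x).
Proof.
move=> cF; elim: n F cF => [|n IH] F cF.
  by under eq_fun do rewrite big_ord0; exact: continuous_cstR.
under eq_fun do rewrite big_ord_recr /=.
by apply: continuous_addR => //; apply: IH => i; exact: cF.
Qed.

End real_continuity.

(** * Inner product, compactness of the sphere, expectation over it *)

Section sphere_expectation.
Context {R : realType} {d : nat}.
Implicit Types (u v y : 'rV[R]_d) (f g phi : 'rV[R]_d -> R).

Lemma continuous_measurable_rV phi (D : set (RdBorel R d)) :
  continuous phi -> measurable D -> measurable_fun D (phi : RdBorel R d -> R).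
Proof.
move=> cphi mD; apply: measurable_funS (subsetT _) _ => //.
apply: (measurability _ (RGenOpens.measurableE R)) => _ [_ [a [b ->] <-]].
rewrite setTI; apply: sub_sigma_algebra.
by apply: open_comp; [move=> x _; exact: cphi|exact: interval_open].
Qed.

Lemma dotvC u v : dotv u v = dotv v u.
Proof. by apply: eq_bigr => i _; rewrite mulrC. Qed.

Lemma dotvDl u v y : dotv (u + v) y = dotv u y + dotv v y.
Proof. by rewrite /dotv -big_split; apply: eq_bigr => i _; rewrite mxE mulrDl. Qed.

Lemma dotvZl a u y : dotv (a *: u) y = a * dotv u y.
Proof. by rewrite /dotv mulr_sumr; apply: eq_bigr => i _; rewrite mxE mulrA. Qed.

Lemma dotvDr u v y : dotv u (v + y) = dotv u v + dotv u y.
Proof. by rewrite dotvC dotvDl ![dotv _ u]dotvC. Qed.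

Lemma dotvZr a u y : dotv u (a *: y) = a * dotv u y.
Proof. by rewrite dotvC dotvZl dotvC. Qed.

Lemma dotv0l y : dotv 0 y = 0.
Proof. by rewrite /dotv big1// => i _; rewrite mxE mul0r. Qed.

Lemma dotv_suml n (F : 'I_n -> 'rV[R]_d) y :
  dotv (\sum_(i < n) F i) y = \sum_(i < n) dotv (F i) y.
Proof.
by apply: (big_ind2 (fun a b => dotv a y = b)) => [|? ? ? ? <- <-|//];
  rewrite ?dotv0l ?dotvDl.
Qed.

Lemma dotv_ge0 u : 0 <= dotv u u.
Proof. by apply: sumr_ge0 => i _; rewrite -expr2 sqr_ge0. Qed.

Lemma continuous_dotv y : continuous (fun u => dotv u y).
Proof.
apply: continuous_sumR => i.
by apply: continuous_mulR; [exact: coord_continuous|exact: continuous_cstR].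
Qed.

Lemma continuous_dotvv : continuous (fun u => dotv u u).
Proof.
apply: continuous_sumR => i.
by apply: continuous_mulR; exact: coord_continuous.
Qed.

Lemma sphereE : @sphere R d = [set u | dotv u u = 1].
Proof.
apply/seteqP; split => u; rewrite /sphere /enorm /=.
  by move=> h; rewrite -[LHS]sqr_sqrtr ?dotv_ge0// h expr1n.
by move=> ->; rewrite sqrtr1.
Qed.

Lemma closed_sphere : closed (@sphere R d).
Proof.
rewrite sphereE; apply: (@closed_comp _ _ (fun u => dotv u u) [set 1]).
  by move=> u _; exact: continuous_dotvv.
exact: closed_eq.
Qed.

Lemma sphere_coord u j : @sphere R d u -> `|u 0 j| <= 1.
Proof.
rewrite sphereE /= => h.
rewrite -[leRHS]sqrtr1 -sqrtr_sqr ler_wsqrtr// -h /dotv (bigD1 j)//= -expr2.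
by rewrite lerDl sumr_ge0// => i _; rewrite -expr2 sqr_ge0.
Qed.

Lemma compact_sphere : compact (@sphere R d).
Proof.
apply: bounded_closed_compact closed_sphere.
exists 1; split => // M M1 u /sphere_coord hu.
rewrite /= [X in X <= _]mx_normrE; apply/bigmax_leP; split=> [|[i j] _ /=].
  by rewrite (le_trans _ (ltW M1)).
by rewrite ord1 (le_trans (hu j)) ?ltW.
Qed.

Lemma measurable_sphere : measurable (@sphere R d : set (RdBorel R d)).
Proof.
rewrite -[X in measurable X]setCK; apply: measurableC.
by apply: sub_sigma_algebra; rewrite openC; exact: closed_sphere.
Qed.

Lemma continuous_sphere_bound phi : continuous phi ->
  exists2 C, 0 <= C & forall u, @sphere R d u -> `|phi u| <= C.
Proof.
move=> cphi; have /compact_bounded [M [_ hM]] : compact (phi @` @sphere R d).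
  by apply: continuous_compact compact_sphere; exact: continuous_subspaceT.
exists (`|M| + 1) => [|u su]; first by rewrite addr_ge0.
by apply: hM; [rewrite (le_lt_trans (ler_norm _))// ltrDl|exists u].
Qed.

Context (P : probability (RdBorel R d) R) (hP : uniform_on_sphere P).

Lemma sphere_prob1 : P (@sphere R d) = 1%E.
Proof.
have := probability_setC P (measurableC measurable_sphere).
by rewrite setCK hP.1 sube0.
Qed.

(** Integrating over the sphere only, which carries all the mass, makes every continuous function
    bounded on the domain, hence integrable. *)
Definition sE phi : R := \int[P]_(u in @sphere R d) phi u.

Lemma sE_integrable phi : continuous phi ->
  P.-integrable (@sphere R d) (EFin \o phi).
Proof.
move=> cphi; have [C C0 hC] := continuous_sphere_bound _ cphi.
have mS := measurable_sphere; apply: (@le_integrable _ _ _ _ _ mS _ (EFin \o cst C)).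
- by apply/measurable_EFinP; apply: continuous_measurable_rV => //; exact: measurable_sphere.
- by move=> u su; rewrite lee_fin (ger0_norm C0) hC.
- exact: finite_measure_integrable_cst.
Qed.

Lemma sE_cst c : sE (fun=> c) = c.
Proof. rewrite /sE Rintegral_cst; last exact: measurable_sphere.
by transitivity (c * fine 1%E); [congr (_ * fine _); exact: sphere_prob1|rewrite mulr1]. Qed.

Lemma sED f g : continuous f -> continuous g ->
  sE (fun u => f u + g u) = sE f + sE g.
Proof.
move=> cf cg; rewrite /sE RintegralD//; first exact: measurable_sphere.
all: exact: sE_integrable.
Qed.

Lemma sEZ c f : continuous f -> sE (fun u => c * f u) = c * sE f.
Proof.
move=> cf; rewrite /sE RintegralZl//; first exact: measurable_sphere.
exact: sE_integrable.
Qed.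

Lemma sE_le f g : continuous f -> continuous g ->
  (forall u, @sphere R d u -> f u <= g u) -> sE f <= sE g.
Proof.
move=> cf cg fg; apply: (le_Rintegral measurable_sphere) => //; exact: sE_integrable.
Qed.

Lemma eq_sE f g : (forall u, @sphere R d u -> f u = g u) -> sE f = sE g.
Proof. by move=> fg; apply: eq_Rintegral => u /set_mem; exact: fg. Qed.

Lemma sE_sum n (F : 'I_n -> 'rV[R]_d -> R) : (forall i, continuous (F i)) ->
  sE (fun u => \sum_(i < n) F i u) = \sum_(i < n) sE (F i).
Proof.
elim: n F => [F _|n IH F cF].
  by rewrite big_ord0; under eq_fun do rewrite big_ord0; rewrite sE_cst.
rewrite big_ord_recr /= -IH//.
under eq_fun do rewrite big_ord_recr /=.
rewrite sED//; apply: continuous_sumR => i; exact: cF.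
Qed.

Lemma sE_chernoff phi c : continuous phi ->
  (P [set u | (c < phi u)%R] <= (sE (fun u => expR (phi u - c)))%:E)%E.
Proof.
move=> cphi.
have cexp : continuous (fun u => expR (phi u - c)).
  apply: continuous_compR; last exact: continuous_expR.
  by apply: continuous_addR => //; exact: continuous_cstR.
have mA : measurable ([set u | (c < phi u)%R] : set (RdBorel R d)).
  apply: sub_sigma_algebra.
  by apply: (@open_comp _ _ phi [set x | c < x]) => // u _; exact: cphi.
have mS := measurable_sphere.
(* The event also contains points off the sphere, which form a null set by [hP]. *)
have -> : P [set u | (c < phi u)%R] = P (@sphere R d `&` [set u | (c < phi u)%R]).
  apply/eqP; rewrite eq_le; apply/andP; split; last first.
    by apply: le_measure; rewrite ?inE//; exact: measurableI.
  rewrite -[X in (P X <= _)%E](setUIDK _ (@sphere R d)) setIC.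
  apply: (le_trans (measureU2 _ _ _)); [exact: measurableI|exact: measurableD|].
  rewrite [X in (_ + X)%E](_ : _ = 0%E) ?adde0//.
  apply/eqP; rewrite -measure_le0 -hP.1; apply: le_measure; rewrite ?inE.
  - exact: measurableD.
  - exact: measurableC.
  - exact: subIsetr.
rewrite fineK; last by apply: integrable_fin_num => //; exact: sE_integrable.
apply: (@le_trans _ _ (\int[P]_(u in @sphere R d `&` [set u | (c < phi u)%R]) cst 1%E u)%E).
  by rewrite integral_cst ?mul1e//; exact: measurableI.
have mexp (D : set (RdBorel R d)) : measurable D ->
    measurable_fun D (fun u => (expR (phi u - c))%:E).
  by move=> mD; apply/measurable_EFinP; exact: continuous_measurable_rV.
apply: (@le_trans _ _
  (\int[P]_(u in @sphere R d `&` [set u | (c < phi u)%R]) (expR (phi u - c))%:E)%E).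
  apply: ge0_le_integral => //.
  - exact: measurableI.
  - by apply: mexp; exact: measurableI.
  - by move=> u [_ /= cu]; rewrite lee_fin -expR0 ler_expR subr_ge0 ltW.
apply: ge0_subset_integral => //.
- exact: measurableI.
- exact: mexp.
Qed.

End sphere_expectation.

(** * Rotation invariance and differentiation under the expectation *)

Section sphere_rotations.
Context {R : realType} {d : nat}.
Context (P : probability (RdBorel R d) R) (hP : uniform_on_sphere P).
Implicit Types (u v y : 'rV[R]_d) (f g phi : 'rV[R]_d -> R).

Lemma dotv_mul (Q : 'M[R]_d) u v : dotv (u *m Q) v = dotv u (v *m Q^T).
Proof.
have dotE (a b : 'rV[R]_d) : dotv a b = (a *m b^T) 0 0.
  by rewrite !mxE; apply: eq_bigr => i _; rewrite !mxE.
by rewrite !dotE trmx_mul trmxK mulmxA.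
Qed.

Lemma sphere_mul (Q : 'M[R]_d) u : Q *m Q^T = 1%:M ->
  @sphere R d (u *m Q) <-> @sphere R d u.
Proof. by move=> QQ; rewrite sphereE /= dotv_mul -mulmxA QQ mulmx1. Qed.

Lemma continuous_mulmxr (Q : 'M[R]_d) : continuous (fun u : 'rV[R]_d => u *m Q).
Proof.
move=> u A [B BQ BA].
(* Neighbourhoods of a matrix are entrywise, so finitely many scalar conditions have to be
   intersected. *)
suff: nbhs u [set v : 'rV[R]_d | forall ij : 'I_1 * 'I_d, B ij.1 ij.2 ((v *m Q) ij.1 ij.2)].
  by apply: (@filterS _ (nbhs u)) => v h; apply: BA => i j; exact: (h (i, j)).
apply: (@filter_forall _ _ (fun ij v => B ij.1 ij.2 ((v *m Q) ij.1 ij.2)) (nbhs u)) => -[i j] /=.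
have cQ : continuous (fun v : 'rV[R]_d => (v *m Q) i j).
  under eq_fun do rewrite mxE.
  apply: continuous_sumR => k; apply: continuous_mulR; last exact: continuous_cstR.
  exact: coord_continuous.
exact: (cQ u _ (BQ i j)).
Qed.

Lemma sE_rotation (Q : 'M[R]_d) phi : is_rotation Q -> continuous phi ->
  sE P (fun u => phi (u *m Q)) = sE P phi.
Proof.
move=> hQ cphi; have mS := @measurable_sphere R d.
pose T : RdBorel R d -> RdBorel R d := fun u : 'rV[R]_d => u *m Q.
have mT : measurable_fun setT T.
  have := @measurability _ _ (RdBorel R d) (RdBorel R d) setT T (@open 'rV[R]_d) erefl; apply => _ [A oA <-].
  rewrite setTI; apply: sub_sigma_algebra.
  by apply: (@open_comp _ _ (fun u : 'rV[R]_d => u *m Q)) => // u _; exact: continuous_mulmxr.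
have ST : T @^-1` (@sphere R d) = @sphere R d.
  by apply/seteqP; split => u /=; rewrite sphere_mul// hQ.1.
have cphiQ : continuous (fun u : 'rV[R]_d => phi (u *m Q)).
  by move=> u; apply: continuous_comp; [exact: continuous_mulmxr|exact: cphi].
have mphi : measurable_fun setT (EFin \o phi : RdBorel R d -> \bar R).
  by apply/measurable_EFinP; exact: continuous_measurable_rV.
rewrite /sE /Rintegral; congr fine.
have := @integral_pushforward _ _ _ _ _ _ mT P _ _ mphi _ mS.
rewrite ST => <-; last exact: sE_integrable.
by apply: eq_measure_integral => A mA _; exact: hP.2.
Qed.

(** Dominated differentiation: compactness of the sphere makes each [F s] integrable, and the
    constant [C] dominates the derivatives for parameters near [s0]. *)
Lemma sE_derive (F DF : R -> 'rV[R]_d -> R) (s0 C : R) :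
  (forall s, continuous (F s)) ->
  (forall (s : R) u, @sphere R d u -> is_derive s (1 : R) (F^~ u) (DF s u)) ->
  (forall s u, `|s - s0| < 1 -> @sphere R d u -> `|DF s u| <= C) ->
  is_derive s0 (1 : R) (fun s => sE P (F s)) (sE P (DF s0)).
Proof.
move=> cF dF bF; have mS := @measurable_sphere R d.
pose I : set R := `]s0 - 1, s0 + 1[%classic.
have Is0 : I s0 by rewrite /I /= in_itv /=; lra.
have intF x : I x -> P.-integrable (@sphere R d) (EFin \o F x).
  by move=> _; exact: sE_integrable.
have derF x u : I x -> @sphere R d u -> derivable (F ^~ u) x 1.
  by move=> _ su; have [] := dF x u su.
have intC : P.-integrable (@sphere R d) (EFin \o cst `|C|).
  exact: finite_measure_integrable_cst.
have bd x u : I x -> @sphere R d u -> `|partial1of2 F x u| <= cst `|C| u.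
  rewrite /I /= in_itv /= => Ix su; rewrite partial1of2E.
  have [_ ->] := dF x u su; apply: le_trans (ler_norm C).
  by apply: bF => //; rewrite ltr_distl; lra.
split; first exact: (derivable_under_integral mS Is0 intF derF _ intC bd).
rewrite -derive1E (differentiation_under_integral mS Is0 intF derF _ intC bd)//.
apply: eq_sE => u su /=; rewrite partial1of2E.
by have [_ ->] := dF s0 u su.
Qed.

End sphere_rotations.

(** * One-parameter groups of rotations *)

Section rodrigues_rotation.
Context {R : realType} {d : nat} (J : 'M[R]_d).
Hypotheses (JT : J^T = - J) (J3 : J *m J *m J = - J).
Implicit Types (u v y : 'rV[R]_d) (s t : R).

(** Rodrigues' formula for the exponential of [s *: J]: the relation [J3] collapses the exponential
    series to these three terms. *)
Definition rodrigues s : 'M[R]_d := 1%:M + sin s *: J + (1 - cos s) *: (J *m J).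

Lemma rodrigues0 : rodrigues 0 = 1%:M.
Proof. by rewrite /rodrigues sin0 cos0 subrr !scale0r !addr0. Qed.

Lemma rodriguesD s t : rodrigues s *m rodrigues t = rodrigues (s + t).
Proof.
have J4 : J *m (J *m J) = - J by rewrite mulmxA.
have JJJJ : J *m J *m (J *m J) = - (J *m J) by rewrite mulmxA J3 mulNmx.
rewrite /rodrigues !mulmxDl !mulmxDr !mul1mx !mulmx1 -!scalemxAl -!scalemxAr.
rewrite !mulmxA J3 mulNmx sinD cosD.
apply/matrixP => i j; rewrite !mxE.
set a := J i j; set b := (\sum_(_ < _) _); set e := ((i == j)%:R).
lra.
Qed.

Lemma rodriguesT s : (rodrigues s)^T = rodrigues (- s).
Proof.
rewrite /rodrigues !linearD /= !linearZ /= trmx1 trmx_mul JT sinN cosN.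
by rewrite mulmxN mulNmx opprK scalerN scaleNr.
Qed.

Lemma rodrigues_orthogonal s : rodrigues s *m (rodrigues s)^T = 1%:M.
Proof. by rewrite rodriguesT rodriguesD subrr rodrigues0. Qed.

(* The determinant is a square, since a rotation by s is twice a rotation by s / 2. *)
Lemma rodrigues_is_rotation s : is_rotation (rodrigues s).
Proof.
split; first exact: rodrigues_orthogonal.
have := congr1 determinant (rodrigues_orthogonal (s / 2)).
by rewrite det_mulmx det_tr det1 -det_mulmx rodriguesD -splitr.
Qed.

(** The right-hand side is the termwise derivative of [rodrigues], so the group moves with velocity
    [J]. *)
Lemma rodrigues_mulr s : rodrigues s *m J = cos s *: J + sin s *: (J *m J).
Proof.
rewrite /rodrigues !mulmxDl mul1mx -!scalemxAl J3 scalerN scalerBl scale1r.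
by rewrite opprB addrC addrA subrK.
Qed.

Lemma is_derive_rodrigues u y s :
  is_derive s (1 : R) (fun t => dotv (u *m rodrigues t) y)
    (dotv (u *m rodrigues s *m J) y).
Proof.
have -> : (fun t => dotv (u *m rodrigues t) y) = (fun t =>
    dotv u y + (sin t * dotv (u *m J) y + (1 - cos t) * dotv (u *m (J *m J)) y)).
  apply/funext => t; rewrite /rodrigues !mulmxDr mulmx1 -!scalemxAr !dotvDl !dotvZl.
  by rewrite addrA.
rewrite -mulmxA rodrigues_mulr mulmxDr -!scalemxAr dotvDl !dotvZl.
set a := dotv _ _; set b := dotv _ _.
apply: is_derive_eq.
rewrite !scaler0 /GRing.scale /=; ring.
Qed.

End rodrigues_rotation.

(** * Generators of the rotations in coordinate planes *)

Section coordinate_planes.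
Context {R : realType} {d : nat}.

Definition plane_mx (j k : 'I_d) : 'M[R]_d := delta_mx j k - delta_mx k j.

Lemma plane_mxT j k : (plane_mx j k)^T = - plane_mx j k.
Proof. by rewrite /plane_mx linearB /= !trmx_delta opprB. Qed.

Lemma plane_mx3 j k : j != k ->
  plane_mx j k *m plane_mx j k *m plane_mx j k = - plane_mx j k.
Proof.
move=> jk; have kj : k != j by rewrite eq_sym.
rewrite /plane_mx; do ! rewrite ?mulmxBl ?mulmxBr ?mulNmx.
rewrite !mul_delta_mx_cond !eqxx (negbTE jk) (negbTE kj) /=.
rewrite !mulr0n !mulr1n !mul0mx !sub0r !subr0.
rewrite !mul_delta_mx_cond !eqxx (negbTE jk) (negbTE kj) /= ?mulr0n ?mulr1n.
by rewrite ?oppr0 ?sub0r ?addr0 ?add0r ?opprK ?opprB ?subr0 addrC.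
Qed.

Lemma mul_plane_mx (u : 'rV[R]_d) j k i :
  (u *m plane_mx j k) 0 i = u 0 j *+ (i == k) - u 0 k *+ (i == j).
Proof.
have E (a b : 'I_d) : (u *m delta_mx a b) 0 i = u 0 a *+ (i == b).
  rewrite mxE (bigD1 a)//= mxE eqxx /= mulr_natr big1 ?addr0// => l la.
  by rewrite mxE (negbTE la) mulr0.
by rewrite /plane_mx mulmxBr mxE [in X in _ + X]mxE !E.
Qed.

End coordinate_planes.

(** * Gradients and integration by parts on the sphere *)

Section gradient.
Context {R : realType} {d : nat}.
Implicit Types (F H : 'rV[R]_d -> R) (G K : 'rV[R]_d -> 'rV[R]_d).

(** The gradient is encoded by the chain rule along curves, whose velocity is tested against every
    vector through [dotv]. This is what rotation orbits require, and it passes directly to sums,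
    products and compositions. *)
Definition is_grad F G := forall (c : R -> 'rV[R]_d) (s : R) (w : 'rV[R]_d),
  (forall y, is_derive s (1 : R) (fun t => dotv (c t) y) (dotv w y)) ->
  is_derive s (1 : R) (fun t => F (c t)) (dotv w (G (c s))).

Definition smooth_grad F G := [/\ is_grad F G, continuous F &
  forall i, continuous (fun u => G u 0 i)].

Lemma dotv_delta (u : 'rV[R]_d) i : dotv u (delta_mx 0 i) = u 0 i.
Proof.
rewrite /dotv (bigD1 i)//= mxE !eqxx mulr1 big1 ?addr0// => k ki.
by rewrite mxE (negbTE ki) andbF mulr0.
Qed.

Lemma smooth_grad_dotv y : smooth_grad (dotv^~ y) (fun=> y).
Proof.
split; [by move=> c s w|exact: continuous_dotv|by move=> i; exact: continuous_cstR].
Qed.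

Lemma smooth_grad_cst a : smooth_grad (fun=> a) (fun=> 0).
Proof.
split; [|exact: continuous_cstR|by move=> i; exact: continuous_cstR].
by move=> c s w _; rewrite dotvC dotv0l; exact: is_derive_cst.
Qed.

Lemma smooth_grad_comp F G (h h' : R -> R) : smooth_grad F G ->
  (forall x, is_derive x (1 : R) h (h' x)) -> continuous h' ->
  smooth_grad (fun u => h (F u)) (fun u => h' (F u) *: G u).
Proof.
move=> [gF cF cG] dh ch'.
have ch : continuous h.
  by move=> x; apply/differentiable_continuous/derivable1_diffP; have [] := dh x.
split.
- move=> c s w dc; have dF := gF c s w dc.
  rewrite dotvC dotvZl dotvC.
  by apply: is_derive_eq; rewrite /GRing.scale /= mulrC.
- exact: continuous_compR.
- move=> i; under eq_fun do rewrite mxE.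
  by apply: continuous_mulR => //; exact: continuous_compR.
Qed.

Lemma smooth_gradM F G H K : smooth_grad F G -> smooth_grad H K ->
  smooth_grad (fun u => F u * H u) (fun u => F u *: K u + H u *: G u).
Proof.
move=> [gF cF cG] [gH cH cK]; split.
- move=> c s w dc; have dF := gF c s w dc; have dH := gH c s w dc.
  rewrite dotvC dotvDl !dotvZl ![dotv _ w]dotvC.
  exact: is_deriveM.
- exact: continuous_mulR.
- move=> i; under eq_fun do rewrite !mxE.
  by apply: continuous_addR; apply: continuous_mulR.
Qed.

Lemma smooth_gradD F G H K : smooth_grad F G -> smooth_grad H K ->
  smooth_grad (fun u => F u + H u) (fun u => G u + K u).
Proof.
move=> [gF cF cG] [gH cH cK]; split.
- move=> c s w dc; have dF := gF c s w dc; have dH := gH c s w dc.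
  rewrite dotvC dotvDl ![dotv _ w]dotvC.
  exact: is_deriveD.
- exact: continuous_addR.
- by move=> i; under eq_fun do rewrite !mxE; exact: continuous_addR.
Qed.

Lemma smooth_grad_sum n (F : 'I_n -> 'rV[R]_d -> R) (G : 'I_n -> 'rV[R]_d -> 'rV[R]_d) :
  (forall i, smooth_grad (F i) (G i)) ->
  smooth_grad (fun u => \sum_(i < n) F i u) (fun u => \sum_(i < n) G i u).
Proof.
elim: n F G => [|n IH] F G hF.
  under eq_fun do rewrite big_ord0; under [X in smooth_grad _ X]eq_fun do rewrite big_ord0.
  exact: smooth_grad_cst.
under eq_fun do rewrite big_ord_recr /=.
under [X in smooth_grad _ X]eq_fun do rewrite big_ord_recr /=.
by apply: smooth_gradD => //; apply: IH.
Qed.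

Context (P : probability (RdBorel R d) R) (hP : uniform_on_sphere P).

(** By invariance the mean of [F] along the rotation orbit does not depend on the angle; this is its
    derivative at angle 0. *)
Lemma sE_rotation_derive F G j k : j != k -> smooth_grad F G ->
  sE P (fun u => dotv (u *m plane_mx j k) (G u)) = 0.
Proof.
move=> jk [gF cF cG]; set J := plane_mx j k.
have JT : J^T = - J := plane_mxT j k.
have J3 : J *m J *m J = - J := plane_mx3 _ _ jk.
set DF := fun u => dotv (u *m J) (G u).
have cDF : continuous DF.
  apply: continuous_sumR => i; apply: continuous_mulR => //.
  under eq_fun do rewrite -dotv_delta dotv_mul.
  exact: continuous_dotv.
have [C C0 hC] := continuous_sphere_bound _ cDF.
have dE : is_derive (0 : R) (1 : R) (fun s => sE P (fun u => F (u *m rodrigues J s)))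
    (sE P (fun u => DF (u *m rodrigues J 0))).
  apply: (@sE_derive _ _ P (fun s u => F (u *m rodrigues J s))
     (fun s u => DF (u *m rodrigues J s)) 0 C).
  - move=> s u; apply: continuous_comp; [exact: continuous_mulmxr|exact: cF].
  - by move=> s u _; apply: gF => y; exact: is_derive_rodrigues.
  - by move=> s u _ su; apply: hC; rewrite sphere_mul//; exact: rodrigues_orthogonal.
have cE : (fun s => sE P (fun u => F (u *m rodrigues J s))) = cst (sE P F).
  by apply/funext => s; apply: sE_rotation => //; exact: rodrigues_is_rotation.
have [_] := dE; rewrite cE derive_cst => ->.
by apply: eq_sE => u _; rewrite rodrigues0 mulmx1.
Qed.

(* Integration by parts on the sphere: [u - <th, u> th] is the spherical gradient
   of [<th, u>], whose spherical Laplacian is [- (d - 1) <th, u>]. *)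
Lemma sE_ibp F G (y : 'rV[R]_d) : smooth_grad F G ->
  (d%:R - 1) * sE P (fun u => dotv u y * F u) =
  sE P (fun u => dotv y (G u) - dotv u y * dotv u (G u)).
Proof.
move=> hFG; have [gF cF cG] := hFG.
have ccoord (i : 'I_d) : continuous (fun u : 'rV[R]_d => u 0 i).
  by move=> u; exact: coord_continuous.
(* [sE_rotation_derive] for the product of the coordinate u_j and [F]: the generator sends u_j to -
   u_k, which produces the right-hand side. *)
have key (j k : 'I_d) : j != k ->
    sE P (fun u => u 0 j * (u 0 j * G u 0 k - u 0 k * G u 0 j)) = sE P (fun u => u 0 k * F u).
  move=> jk.
  have := sE_rotation_derive _ _ _ _ jk (smooth_gradM _ _ _ _ (smooth_grad_dotv (delta_mx 0 j)) hFG).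
  have -> : (fun u => dotv (u *m plane_mx j k)
     (dotv u (delta_mx 0 j) *: G u + F u *: delta_mx 0 j)) =
     (fun u => u 0 j * (u 0 j * G u 0 k - u 0 k * G u 0 j) + (-1) * (u 0 k * F u)).
    apply/funext => u; rewrite dotvC dotvDl !dotvZl dotv_delta.
    rewrite [dotv (delta_mx _ _) _]dotvC dotv_delta mul_plane_mx.
    rewrite eqxx (negbTE jk) mulr0n mulr1n sub0r [dotv (G u) _]dotvC.
    have -> : dotv (u *m plane_mx j k) (G u) = u 0 j * G u 0 k - u 0 k * G u 0 j.
      rewrite {1}/dotv; under eq_bigr do rewrite mul_plane_mx mulrBl !mulrb.
      rewrite sumrB; congr (_ - _).
        rewrite (bigD1 k)//= eqxx big1 ?addr0// => i ik.
        by rewrite (negbTE ik) mul0r.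
      rewrite (bigD1 j)//= eqxx big1 ?addr0// => i ij.
      by rewrite (negbTE ij) mul0r.
    ring.
  rewrite sED; last 2 first.
  - by apply: continuous_mulR => //; apply: continuous_addR;
      [|apply: continuous_oppR]; apply: continuous_mulR.
  - by apply: continuous_mulR; [exact: continuous_cstR|exact: continuous_mulR].
  rewrite sEZ; last exact: continuous_mulR.
  by move=> h; apply/eqP; rewrite -subr_eq0 -mulN1r h.
have ccG (i j k : 'I_d) : continuous (fun u : 'rV[R]_d => u 0 i * (u 0 j * G u 0 k)).
  by apply: continuous_mulR => //; apply: continuous_mulR.
have cdG : continuous (fun u => dotv u (G u)).
  by apply: continuous_sumR => i; apply: continuous_mulR.
(* Sum [key] over all j different from k, which gives the factor d - 1. The term j = k vanishes and
   can be added, and the sum of the u_j^2 is 1 on the sphere. *)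
have coordE (k : 'I_d) : (d%:R - 1) * sE P (fun u => u 0 k * F u) =
    sE P (fun u => G u 0 k - u 0 k * dotv u (G u)).
  have -> : (d%:R - 1) * sE P (fun u => u 0 k * F u) =
      \sum_(j < d) sE P (fun u => u 0 j * (u 0 j * G u 0 k - u 0 k * G u 0 j)).
    rewrite (bigD1 k)//= (eq_bigr (fun=> sE P (fun u => u 0 k * F u))); last first.
      by move=> j jk; exact: key.
    have -> : sE P (fun u => u 0 k * (u 0 k * G u 0 k - u 0 k * G u 0 k)) = 0.
      by rewrite -[RHS](sE_cst P hP); apply: eq_sE => u _; rewrite subrr mulr0.
    rewrite [RHS]add0r [RHS]sumr_const cardC1 card_ord -[RHS]mulr_natl -subn1 natrB//.
    exact: leq_ltn_trans (leq0n k) (ltn_ord k).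
  rewrite -sE_sum//; last first.
    by move=> j; under eq_fun do rewrite mulrBr; apply: continuous_addR => //;
      apply: continuous_oppR.
  apply: eq_sE => u; rewrite sphereE /= => su.
  rewrite -[in RHS](mul1r (G u 0 k)) -su /dotv mulr_suml mulr_sumr -sumrB.
  by apply: eq_bigr => j _; ring.
have -> : sE P (fun u => dotv u y * F u) = \sum_(k < d) y 0 k * sE P (fun u => u 0 k * F u).
  transitivity (\sum_(k < d) sE P (fun u => y 0 k * (u 0 k * F u))); last first.
    by apply: eq_bigr => k _; rewrite sEZ//; exact: continuous_mulR.
  rewrite -sE_sum//; last first.
    move=> k; apply: continuous_mulR; [exact: continuous_cstR|exact: continuous_mulR].
  apply: eq_sE => u _; rewrite mulr_suml; apply: eq_bigr => k _; ring.
rewrite mulr_sumr.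
under eq_bigr do rewrite mulrCA coordE.
have cc k : continuous (fun u => G u 0 k - u 0 k * dotv u (G u)).
  by apply: continuous_addR => //; apply: continuous_oppR; apply: continuous_mulR.
transitivity (\sum_(k < d) sE P (fun u => y 0 k * (G u 0 k - u 0 k * dotv u (G u)))).
  by apply: eq_bigr => k _; rewrite sEZ.
rewrite -sE_sum//; last first.
  by move=> k; apply: continuous_mulR => //; exact: continuous_cstR.
apply: eq_sE => u _.
move: (dotv u (G u)) => D; rewrite /dotv mulr_suml -sumrB.
by apply: eq_bigr => k _; ring.
Qed.

End gradient.

(** * The standard Gaussian density and its primitives *)

Section gaussian_density.
Context {R : realType}.
Local Notation mu := (@lebesgue_measure R).
Local Notation phi := (normal_pdf (0 : R) 1).
Implicit Types (x w t : R).

Lemma normal_pdf01E x : phi x = phi 0 * expR (- (x ^+ 2 / 2)).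
Proof.
rewrite !normal_pdfE ?oner_eq0//= /normal_fun subrr subr0 expr0n /= oppr0 mul0r expR0 mulr1.
by rewrite expr1n mulNr.
Qed.

Lemma normal_pdf01_gt0 x : 0 < phi x.
Proof.
rewrite normal_pdfE ?oner_eq0//= mulr_gt0 ?expR_gt0// normal_peak_gt0//.
Qed.

Lemma normal_pdf01_ge0 x : 0 <= phi x. Proof. exact/ltW/normal_pdf01_gt0. Qed.

Lemma continuous_normal_pdf01 : continuous phi.
Proof. exact/continuous_normal_pdf/oner_neq0. Qed.

Lemma normal_pdf01N x : phi (- x) = phi x.
Proof. by rewrite normal_pdf01E sqrrN -normal_pdf01E. Qed.

Lemma normal_pdf01_norm x : phi `|x| = phi x.
Proof. by rewrite normal_pdf01E real_normK ?num_real// -normal_pdf01E. Qed.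

Lemma normal_pdf01_le x t : 0 <= x <= t -> phi t <= phi x.
Proof.
move=> /andP[x0 xt]; rewrite [leLHS]normal_pdf01E [leRHS]normal_pdf01E.
rewrite ler_pM2l ?normal_pdf01_gt0// ler_expR lerN2 ler_pM2r ?invr_gt0//.
by rewrite ler_sqr ?nnegrE// (le_trans x0).
Qed.

Global Instance is_derive_normal_pdf01 x : is_derive x (1 : R) phi (- (x * phi x)).
Proof.
have -> : phi = (fun t => phi 0 * expR (- (t ^+ 2 / 2))).
  by apply/funext => t; exact: normal_pdf01E.
apply: is_derive_eq.
rewrite /GRing.scale /=; set e := expR _; set p := phi 0.
by field.
Qed.

(** The value is 1 / sqrt(2 pi), and 2 pi >= 4. Since E|Z| = 2 phi(0), this gives E|Z| <= 1. *)
Lemma normal_pdf01_0_le : phi 0 <= 1 / 2.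
Proof.
rewrite normal_pdfE ?oner_eq0//= /normal_fun subrr expr0n /= oppr0 mul0r expR0 mulr1.
rewrite /normal_peak expr1n mul1r div1r.
have pi2 : 4 <= pi *+ 2 :> R by rewrite -mulr_natr; have := @pi_ge2 R; lra.
rewrite lef_pV2 ?posrE ?sqrtr_gt0//; last exact: lt_le_trans pi2.
have -> : 2 = Num.sqrt (2 ^+ 2) :> R by rewrite sqrtr_sqr ger0_norm.
by rewrite ler_wsqrtr// (le_trans _ pi2)// -natrX.
Qed.

(** Crude decay from exp y >= y, enough to make both phi(x) and x phi(x) vanish at infinity. *)
Lemma normal_pdf01_le_invsqr x : 0 < x -> phi x <= x ^- 2.
Proof.
move=> x0; rewrite normal_pdf01E expRN.
have hx : x ^+ 2 / 2 <= expR (x ^+ 2 / 2).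
  by apply: le_trans (expR_ge1Dx _); rewrite lerDr.
have x2 : 0 < x ^+ 2 by rewrite exprn_gt0.
apply: (@le_trans _ _ (1 / 2 * (x ^+ 2 / 2)^-1)).
  apply: ler_pM; [exact: normal_pdf01_ge0|by rewrite invr_ge0 expR_ge0|exact: normal_pdf01_0_le|].
  by rewrite lef_pV2// posrE ?expR_gt0// divr_gt0.
by rewrite le_eqVlt; apply/orP; left; apply/eqP; field; rewrite gt_eqF.
Qed.

Lemma cvgy_inv_bound (f : R -> R) : (forall x, 0 < x -> `|f x| <= x^-1) ->
  f x @[x --> +oo] --> (0 : R).
Proof.
move=> hf; apply/cvgr0Pnorm_le => e e0; near=> x.
have x0 : 0 < x by near: x; exact: nbhs_pinfty_gt.
have ex : e^-1 < x by near: x; apply: nbhs_pinfty_gt; rewrite num_real.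
apply: (le_trans (hf x x0)); rewrite invf_ple ?posrE//; exact: ltW.
Unshelve. all: by end_near. Qed.

Lemma cvgy_mul_normal_pdf01 : x * phi x @[x --> +oo] --> (0 : R).
Proof.
apply: cvgy_inv_bound => x x0.
rewrite ger0_norm; last by rewrite mulr_ge0 ?ltW// normal_pdf01_gt0.
have -> : x^-1 = x * x ^- 2 by field; rewrite gt_eqF.
by rewrite ler_pM2l// normal_pdf01_le_invsqr.
Qed.

Lemma cvgy_normal_pdf01 : phi x @[x --> +oo] --> (0 : R).
Proof.
apply: cvgy_inv_bound => x x0; rewrite ger0_norm ?normal_pdf01_ge0//.
have [x1|x1] := lerP 1 x.
  apply: le_trans (normal_pdf01_le_invsqr _ x0) _.
  by rewrite lef_pV2 ?posrE ?exprn_gt0// expr2 ler_peMl// ltW.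
apply: (@le_trans _ _ (phi 0)); first by rewrite normal_pdf01_le// lexx ltW.
apply: le_trans normal_pdf01_0_le _; apply: (@le_trans _ _ 1); first by lra.
by rewrite -invr1 lef_pV2 ?posrE// ltW.
Qed.

Lemma integrable_normal_pdf01 (D : set R) : measurable D ->
  mu.-integrable D (EFin \o phi).
Proof. by move=> mD; apply: integrableS (integrable_normal_pdf 0 1). Qed.

Lemma Rintegral_normal_pdf01 : \int[mu]_x phi x = 1.
Proof. by rewrite /Rintegral (integral_normal_pdf 0 1). Qed.

Let phi_derive1 (x : R) : derive1 phi x = - (x * phi x).
Proof. by rewrite derive1E derive_val. Qed.

Let phi_derivable (x : R) : derivable phi x 1.
Proof. by have [] := is_derive_normal_pdf01 x. Qed.

Lemma continuous_idR : continuous (fun x : R => x).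
Proof. by move=> x. Qed.

Lemma integral_tail1 w : 0 <= w ->
  (\int[mu]_(x in `[w, +oo[) (x * phi x)%:E = (phi w)%:E)%E.
Proof.
move=> w0.
rewrite (@ge0_continuous_FTC2y _ _ (fun x => - phi x) w 0).
- by rewrite sub0e EFinN oppeK.
- by move=> x wx; rewrite mulr_ge0 ?normal_pdf01_ge0// (le_trans w0).
- apply: continuous_subspaceT.
  by apply: continuous_mulR; [exact: continuous_idR|exact: continuous_normal_pdf01].
- have : - phi x @[x --> +oo] --> - (0 : R) by apply: cvgN; exact: cvgy_normal_pdf01.
  by rewrite oppr0.
- by move=> x _; exact: derivableN.
- by apply: cvg_at_right_filter; apply: cvgN; exact: continuous_normal_pdf01.
- by move=> x _; rewrite derive1E deriveN// -derive1E phi_derive1 opprK.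
Qed.

(** A primitive is - x phi(x). The condition [1 <= w] keeps the integrand nonnegative, as the
    fundamental theorem on a half-line is used here for nonnegative functions. *)
Lemma integral_tail2 w : 1 <= w ->
  (\int[mu]_(x in `[w, +oo[) ((x ^+ 2 - 1) * phi x)%:E = (w * phi w)%:E)%E.
Proof.
move=> w1.
have dF (x : R) : is_derive x (1 : R) (fun x => - (x * phi x)) ((x ^+ 2 - 1) * phi x).
  by apply: is_derive_eq; rewrite /GRing.scale /=; ring.
rewrite (@ge0_continuous_FTC2y _ _ (fun x => - (x * phi x)) w 0).
- by rewrite sub0e EFinN oppeK.
- move=> x wx; rewrite mulr_ge0 ?normal_pdf01_ge0// subr_ge0.
  by have x1 := le_trans w1 wx; rewrite expr2 mulr_ege1.
- apply: continuous_subspaceT.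
  apply: continuous_mulR; last exact: continuous_normal_pdf01.
  apply: continuous_addR; last exact: continuous_cstR.
  by move=> x; exact: exprn_continuous.
- have : - (x * phi x) @[x --> +oo] --> - (0 : R) by apply: cvgN; exact: cvgy_mul_normal_pdf01.
  by rewrite oppr0.
- by move=> x _; have [] := dF x.
- apply: cvg_at_right_filter; apply: cvgN.
  by apply: continuous_mulR; [exact: continuous_idR|exact: continuous_normal_pdf01].
- by move=> x _; rewrite derive1E; have [_ ->] := dF x.
Qed.

End gaussian_density.

(** * Gaussian tail integrals and Mills ratio bounds *)

Section gaussian_tails.
Context {R : realType}.
Local Notation mu := (@lebesgue_measure R).
Local Notation phi := (normal_pdf (0 : R) 1).
Implicit Types (x w t a : R).

Lemma lebesgue_integrableD (D : set R) (f g : R -> R) : measurable D ->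
  mu.-integrable D (EFin \o f) -> mu.-integrable D (EFin \o g) ->
  mu.-integrable D (EFin \o (fun x => f x + g x)).
Proof.
move=> mD i j; rewrite (_ : _ \o _ = ((EFin \o f) \+ (EFin \o g))%E) //.
exact: integrableD.
Qed.

Lemma lebesgue_integrableZ (D : set R) (c : R) (f : R -> R) : measurable D ->
  mu.-integrable D (EFin \o f) -> mu.-integrable D (EFin \o (fun x => c * f x)).
Proof.
move=> mD i; rewrite (_ : _ \o _ = fun x => (c%:E * (EFin \o f) x)%E).
  exact: integrableZl.
by apply/funext => x /=; rewrite EFinM.
Qed.

Lemma lebesgue_norm_Rintegral_le (D : set R) (f g : R -> R) : measurable D ->
  mu.-integrable D (EFin \o f) -> mu.-integrable D (EFin \o g) ->
  (forall x, D x -> `|f x| <= g x) ->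
  `|\int[mu]_(x in D) f x| <= \int[mu]_(x in D) g x.
Proof.
move=> mD i j fg.
have h : `|\int[mu]_(x in D) f x| <= \int[mu]_(x in D) `|f x|.
  by apply: le_normr_Rintegral.
apply: (le_trans h); apply: le_Rintegral => //.
by move/integrable_abse : i; apply: eq_integrable.
Qed.

Let cnphi : continuous (fun x : R => `|x| * phi x).
Proof.
apply: continuous_mulR; last exact: continuous_normal_pdf01.
by move=> x; apply: (cvg_norm (V := R^o)); exact: cvg_id.
Qed.

Let nphi_ge0 (x : R) : 0 <= `|x| * phi x.
Proof. by rewrite mulr_ge0// normal_pdf01_ge0. Qed.

Lemma integralT_norm_normal_pdf01 :
  (\int[mu]_x (`|x| * phi x)%:E = (2 * phi 0)%:E)%E.
Proof.
rewrite ge0_symfun_integralT//; last first.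
  by move=> x /=; rewrite normrN normal_pdf01N.
rewrite -set_itvcy EFinM -(integral_tail1 0 (lexx _)); congr (_ * _)%E.
by apply: eq_integral => x; rewrite inE /= in_itv /= andbT => x0; rewrite ger0_norm.
Qed.

Lemma integrable_norm_normal_pdf01 (D : set R) : measurable D ->
  mu.-integrable D (EFin \o (fun x => `|x| * phi x)).
Proof.
move=> mD; apply: (@integrableS _ _ _ _ setT) => //.
apply/integrableP; split.
  by apply/measurable_EFinP; exact: continuous_measurable_fun.
under eq_integral do rewrite /= ger0_norm//.
by rewrite integralT_norm_normal_pdf01 ltry.
Qed.

Lemma RintegralT_norm_normal_pdf01 : \int[mu]_x (`|x| * phi x) <= 1.
Proof.
rewrite /Rintegral integralT_norm_normal_pdf01 /=.
by have := @normal_pdf01_0_le R; lra.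
Qed.

Lemma integrable_cst_normal_pdf01 (c : R) (D : set R) : measurable D ->
  mu.-integrable D (EFin \o (fun x => c * phi x)).
Proof.
by move=> mD; apply: lebesgue_integrableZ => //; exact: integrable_normal_pdf01.
Qed.

Lemma integrable_cst_norm_normal_pdf01 (c : R) (D : set R) : measurable D ->
  mu.-integrable D (EFin \o (fun x => c * (`|x| * phi x))).
Proof.
by move=> mD; apply: lebesgue_integrableZ => //; exact: integrable_norm_normal_pdf01.
Qed.

Definition gauss_tail a : R := \int[mu]_(x in `[a, +oo[) phi x.

Lemma Rintegral_norm_tail a : 0 <= a ->
  \int[mu]_(x in `[a, +oo[) (`|x| * phi x) = phi a.
Proof.
move=> a0; rewrite /Rintegral -[RHS]/(fine (phi a)%:E) -(integral_tail1 a a0).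
congr fine; apply: eq_integral => x; rewrite inE /= in_itv /= andbT => ax.
by rewrite ger0_norm// (le_trans a0).
Qed.

(** Upper Mills bound: on the tail a <= x, and x phi(x) integrates to phi(a). *)
Lemma mul_gauss_tail_le a : 0 <= a -> a * gauss_tail a <= phi a.
Proof.
move=> a0; rewrite -(Rintegral_norm_tail a a0) /gauss_tail -RintegralZl//; last first.
  exact: integrable_normal_pdf01.
apply: le_Rintegral => //.
- exact: integrable_cst_normal_pdf01.
- exact: integrable_norm_normal_pdf01.
- move=> x /=; rewrite in_itv /= andbT => ax.
  by rewrite ler_wpM2r ?normal_pdf01_ge0// (le_trans ax)// ler_norm.
Qed.

Lemma gauss_tail_ge0 a : 0 <= gauss_tail a.
Proof. by apply: Rintegral_ge0 => x _; exact: normal_pdf01_ge0. Qed.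

(** For a >= 1 the Mills bound suffices. For a < 1 the tail is cut at 1: the interval [a, 1] has
    length at most 1, and the tail beyond 1 is at most phi(1); each piece costs at most phi(a). *)
Lemma gauss_tail_le2 a : 0 <= a -> gauss_tail a <= 2 * phi a.
Proof.
move=> a0; have [a1|a1] := lerP 1 a.
  apply: (@le_trans _ _ (a * gauss_tail a)); first by rewrite ler_peMl// gauss_tail_ge0.
  apply: le_trans (mul_gauss_tail_le a a0) _.
  by rewrite ler_peMl ?normal_pdf01_ge0//; lra.
have itf := @integrable_normal_pdf01 R.
have := @Rintegral_itvB R phi (BLeft a) (BInfty R false) 1.
rewrite Rintegral_itv_obnd_cbnd; last exact: itf.
move=> /(_ (itf _ (measurable_itv _))).
rewrite -/(gauss_tail a) -/(gauss_tail 1) !bnd_simp => /(_ (ltW a1) isT) E.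
have I1 : \int[mu]_(x in `[a, 1]) phi x <= (1 - a) * phi a.
  apply: (@le_trans _ _ (\int[mu]_(x in `[a, 1]) cst (phi a) x)).
    apply: le_Rintegral => //.
    - exact: itf.
    - apply/integrableP; split; first exact/measurable_EFinP.
      rewrite /= integral_cst//= lebesgue_measure_itv /= lte_fin a1.
      by rewrite -EFinB -EFinM ltry.
    - by move=> x /=; rewrite in_itv /= => /andP[ax _]; rewrite normal_pdf01_le// a0.
  rewrite Rintegral_cst//= lebesgue_measure_itv /= lte_fin a1 /=.
  by rewrite mulrC.
have I2 : gauss_tail 1 <= phi a.
  have := mul_gauss_tail_le 1 ler01; rewrite mul1r => /le_trans; apply.
  by rewrite normal_pdf01_le// a0 ltW.
have : (1 - a) * phi a <= phi a.
  by rewrite ler_piMl ?normal_pdf01_ge0// gerBl.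
by move: E I1 I2; clear; lra.
Qed.

Lemma integrable_tail2 a : 1 <= a ->
  mu.-integrable `[a, +oo[ (EFin \o (fun x => (x ^+ 2 - 1) * phi x)).
Proof.
move=> a1; apply/integrableP; split.
  apply/measurable_EFinP; apply: measurable_funTS.
  have : continuous (fun x : R => (x ^+ 2 - 1) * phi x); last exact: continuous_measurable_fun.
  apply: continuous_mulR; last exact: continuous_normal_pdf01.
  apply: continuous_addR; last exact: continuous_cstR.
  by move=> x; exact: exprn_continuous.
rewrite [ltLHS](_ : _ = (a * phi a)%:E) ?ltry// -integral_tail2//.
apply: eq_integral => x; rewrite inE /= in_itv /= andbT => ax; rewrite ger0_norm//.
rewrite mulr_ge0 ?normal_pdf01_ge0// subr_ge0.
by have x1 := le_trans a1 ax; rewrite expr2 mulr_ege1.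
Qed.

(** Lower Mills bound: expand the nonnegative integral of (x - a)^2 phi(x) over the tail as (x^2 -
    1) - 2 a x + (1 + a^2), whose terms integrate to a phi(a), - 2 a phi(a) and (1 + a^2) times the
    tail. *)
Lemma gauss_tail_ge a : 1 <= a -> a * phi a <= (1 + a ^+ 2) * gauss_tail a.
Proof.
move=> a1; have a0 : 0 <= a by lra.
have mT : measurable (`[a, +oo[%classic : set R) by [].
have i2 := integrable_tail2 a a1.
have i1 := integrable_cst_norm_normal_pdf01 (- (2 * a)) _ mT.
have i0 := integrable_cst_normal_pdf01 (1 + a ^+ 2) _ mT.
have i21 : mu.-integrable `[a, +oo[
   (EFin \o (fun x => (x ^+ 2 - 1) * phi x + - (2 * a) * (`|x| * phi x))).
  exact: lebesgue_integrableD.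
have : 0 <= \int[mu]_(x in `[a, +oo[) ((x ^+ 2 - 1) * phi x +
     - (2 * a) * (`|x| * phi x) + (1 + a ^+ 2) * phi x).
  apply: Rintegral_ge0 => x /=; rewrite in_itv /= andbT => ax.
  rewrite (ger0_norm (le_trans a0 ax)).
  have -> : (x ^+ 2 - 1) * phi x + - (2 * a) * (x * phi x) + (1 + a ^+ 2) * phi x =
    (x - a) ^+ 2 * phi x by ring.
  by rewrite mulr_ge0 ?sqr_ge0 ?normal_pdf01_ge0.
rewrite RintegralD// RintegralD//.
have -> : \int[mu]_(x in `[a, +oo[) (- (2 * a) * (`|x| * phi x)) = - (2 * a) * phi a.
  by rewrite RintegralZl ?Rintegral_norm_tail//; exact: integrable_norm_normal_pdf01.
have -> : \int[mu]_(x in `[a, +oo[) ((1 + a ^+ 2) * phi x) = (1 + a ^+ 2) * gauss_tail a.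
  by rewrite RintegralZl//; exact: integrable_normal_pdf01.
have -> : \int[mu]_(x in `[a, +oo[) ((x ^+ 2 - 1) * phi x) = a * phi a.
  by rewrite /Rintegral integral_tail2.
by clear; lra.
Qed.

(* [D] is the tail of the standard Gaussian beyond [w], on the side of [w];
   [\int_(t <= w) k = - \int_(t >= w) k] for [k] of integral 0. *)
Lemma gaussian_tail_set w : exists2 D : set R, measurable D &
  [/\ \int[mu]_(x in D) phi x = gauss_tail `|w|,
      \int[mu]_(x in D) (`|x| * phi x) = phi w,
      forall t, D t -> `|t - w| = `|t| - `|w| &
      forall k : R -> R, mu.-integrable setT (EFin \o k) -> \int[mu]_x k x = 0 ->
        `|\int[mu]_(x in `]-oo, w]) k x| = `|\int[mu]_(x in D) k x| /\
        w * \int[mu]_(x in `]-oo, w]) k x = - (`|w| * \int[mu]_(x in D) k x)].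
Proof.
have [w0|w0] := lerP 0 w.
  exists `[w, +oo[%classic => //; split => //.
  - by rewrite ger0_norm.
  - exact: Rintegral_norm_tail.
  - move=> t /=; rewrite in_itv /= andbT => wt.
    by rewrite !ger0_norm ?subr_ge0// (le_trans w0).
  - move=> k ik k0.
    have := @Rintegral_itvB R k (BInfty R true) (BInfty R false) w.
    rewrite set_itvNyy k0 Rintegral_itv_obnd_cbnd; last first.
      by apply: integrableS ik.
    move=> /(_ ik isT isT); rewrite sub0r => <-.
    by rewrite normrN mulrN opprK (ger0_norm w0).
exists `]-oo, w]%classic => //.
(* Reflection turns the left tail at a negative w into the right tail at - w. *)
have sub (G : R -> R) : continuous G -> (forall x, 0 <= G x) -> (forall x, G (- x) = G x) ->
    \int[mu]_(x in `]-oo, w]) G x = \int[mu]_(x in `[- w, +oo[) G x.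
  move=> cG G0 GN; rewrite /Rintegral; congr fine.
  have := @ge0_integration_by_substitutionNy R G (- w); rewrite opprK => ->//.
  - by apply: eq_integral => x _ /=; rewrite GN.
  - exact: continuous_subspaceT.
split.
- rewrite (ltr0_norm w0) sub//; [exact: continuous_normal_pdf01|exact: normal_pdf01_ge0|exact: normal_pdf01N].
- rewrite sub//; last by move=> x; rewrite normrN normal_pdf01N.
  by rewrite Rintegral_norm_tail ?normal_pdf01N// oppr_ge0 ltW.
- move=> t /=; rewrite in_itv /= => tw.
  have t0 := le_lt_trans tw w0.
  by rewrite (ltr0_norm t0) (ltr0_norm w0) ler0_norm ?subr_le0//; ring.
- by move=> k _ _; rewrite (ltr0_norm w0) mulNr opprK.
Qed.

End gaussian_tails.

(** * Solution of the Gaussian Stein equation and its bounds *)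

Section gaussian_stein.
Context {R : realType}.
Local Notation mu := (@lebesgue_measure R).
Local Notation phi := (normal_pdf (0 : R) 1).
Implicit Types (x w t : R) (D : set R).

Section bounded.
Context (h : R -> R) (a : R) (ch : continuous h) (ha : forall x, `|h x| <= a).

Lemma integrable_mul_normal_pdf01 D : measurable D ->
  mu.-integrable D (EFin \o (fun x => h x * phi x)).
Proof.
move=> mD; have := integrable_cst_normal_pdf01 a D mD; apply: le_integrable => //.
- apply/measurable_EFinP; apply: measurable_funTS.
  have : continuous (fun x => h x * phi x); last exact: continuous_measurable_fun.
  by apply: continuous_mulR => //; exact: continuous_normal_pdf01.
- move=> x _; rewrite lee_fin !normrM ler_wpM2r// (le_trans (ha x))//.
  exact: ler_norm.
Qed.

Lemma norm_Rintegral_normal_pdf01_le D : measurable D ->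
  `|\int[mu]_(x in D) (h x * phi x)| <= a * \int[mu]_(x in D) phi x.
Proof.
move=> mD; rewrite -RintegralZl//; last exact: integrable_normal_pdf01.
apply: lebesgue_norm_Rintegral_le => //.
- exact: integrable_mul_normal_pdf01.
- exact: integrable_cst_normal_pdf01.
- move=> x _; rewrite normrM (ger0_norm (normal_pdf01_ge0 _)).
  by rewrite ler_wpM2r// normal_pdf01_ge0.
Qed.

End bounded.

Context (h : R -> R) (a l : R) (ch : continuous h) (ha : forall x, `|h x| <= a).
Context (hl : forall x y, `|h x - h y| <= l * `|x - y|).
Let N : R := \int[mu]_x (h x * phi x).

Let l0 : 0 <= l.
Proof. by have := hl 1 0; rewrite subr0 normr1 mulr1; exact: le_trans. Qed.

Let a0 : 0 <= a.
Proof. exact: le_trans (ha 0). Qed.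

Let N_le : `|N| <= a.
Proof.
have := norm_Rintegral_normal_pdf01_le h a ch ha setT measurableT.
by rewrite Rintegral_normal_pdf01 mulr1.
Qed.

(** Average |h t - h x| <= l (|t| + |x|) over the Gaussian x; the 1 bounds E|Z|. *)
Let hN_le t : `|h t - N| <= l * (`|t| + 1).
Proof.
have mT : measurable (setT : set R) by [].
have iphi := @integrable_normal_pdf01 R setT mT.
have ih := integrable_mul_normal_pdf01 h a ch ha setT mT.
have -> : h t - N = \int[mu]_x (h t * phi x - h x * phi x).
  rewrite RintegralB//; last exact: integrable_cst_normal_pdf01.
  by rewrite RintegralZl// Rintegral_normal_pdf01 mulr1.
have id : mu.-integrable setT (EFin \o (fun x => h t * phi x - h x * phi x)).
  rewrite (_ : (fun x => h t * phi x - h x * phi x) =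
     (fun x => h t * phi x + -1 * (h x * phi x))); last by apply/funext => x; ring.
  apply: lebesgue_integrableD => //; first exact: integrable_cst_normal_pdf01.
  exact: lebesgue_integrableZ.
apply: (@le_trans _ _ (\int[mu]_x (l * `|t| * phi x + l * (`|x| * phi x)))).
  apply: lebesgue_norm_Rintegral_le => //.
  - apply: lebesgue_integrableD => //; first exact: integrable_cst_normal_pdf01.
    exact: integrable_cst_norm_normal_pdf01.
  - move=> x _; rewrite -mulrBl normrM (ger0_norm (normal_pdf01_ge0 _)) mulrA -mulrDl -mulrDr.
    rewrite ler_wpM2r ?normal_pdf01_ge0// (le_trans (hl _ _))// ler_wpM2l//.
    exact: ler_normB.
rewrite RintegralD//; last 2 first.
- exact: integrable_cst_normal_pdf01.
- exact: integrable_cst_norm_normal_pdf01.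
rewrite RintegralZl// [X in _ + X]RintegralZl//; last exact: integrable_norm_normal_pdf01.
rewrite Rintegral_normal_pdf01 mulr1 mulrDr lerD2l ler_wpM2l//.
exact: RintegralT_norm_normal_pdf01.
Qed.

Let k x := (h x - N) * phi x.

Let ck : continuous k.
Proof.
apply: continuous_mulR; last exact: continuous_normal_pdf01.
by apply: continuous_addR => //; exact: continuous_cstR.
Qed.

Let kE D : measurable D ->
  mu.-integrable D (EFin \o k) /\ \int[mu]_(x in D) k x =
    \int[mu]_(x in D) (h x * phi x) - N * \int[mu]_(x in D) phi x.
Proof.
move=> mD; have ih := integrable_mul_normal_pdf01 h a ch ha D mD.
have iN := integrable_cst_normal_pdf01 N D mD.
have -> : k = (fun x => h x * phi x - N * phi x).
  by apply/funext => x; rewrite /k mulrBl.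
split; last by rewrite RintegralB// RintegralZl//; exact: integrable_normal_pdf01.
rewrite (_ : (fun x => h x * phi x - N * phi x) =
   (fun x => h x * phi x + -1 * (N * phi x))); last by apply/funext => x; ring.
by apply: lebesgue_integrableD => //; exact: lebesgue_integrableZ.
Qed.

Let k_int0 : \int[mu]_x k x = 0.
Proof. by have [//|_ ->] := kE setT; rewrite Rintegral_normal_pdf01 mulr1 subrr. Qed.

(** The density is an integrating factor: the Stein equation for g reads (g phi)' = (h - N) phi =
    [k]. *)
Definition stein_primitive w : R := \int[mu]_(x in `]-oo, w]) k x.
Definition stein_sol w : R := stein_primitive w / phi w.
(** Defined by the Stein equation itself; that it is the derivative of [stein_sol] is proved
    next. *)
Definition stein_sol' w : R := w * stein_sol w + (h w - N).

Lemma is_derive_stein_sol w : is_derive w (1 : R) stein_sol (stein_sol' w).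
Proof.
have dU : is_derive w (1 : R) stein_primitive (k w).
  have w1 : w < w + 1 by rewrite ltrDl.
  have [ik _] := kE `]-oo, w + 1]%classic (measurable_itv _).
  have [dU dE] := @continuous_FTC1 R k (BInfty R true) w (w + 1) w1 ik (ltNyr w) (ck w).
  by split; [exact: dU|rewrite -derive1E; exact: dE].
have p0 : phi w != 0 by rewrite gt_eqF ?normal_pdf01_gt0.
have dV : is_derive w (1 : R) (fun x => (phi x)^-1) (- phi w ^- 2 *: (- (w * phi w))).
  exact: is_deriveV.
apply: is_derive_eq (is_deriveM dU dV) _.
by rewrite /stein_sol' /stein_sol /k /GRing.scale /=; field.
Qed.

(** All the estimates needed for the three bounds below, stated without reference to the sign of w.
    [K] is the Gaussian tail beyond |w| and [H] the integral of h phi over the tail on the side of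
    w; as [k] has integral 0, the solution can be computed from that tail. *)
Let tail w : exists K H : R, [/\ `|stein_sol w| * phi w <= l * (phi w + K),
  stein_sol' w * phi w = phi w * (h w - N) - `|w| * (H - N * K),
  `|H| <= a * K, `|H - h w * K| <= l * (phi w - `|w| * K) &
  [/\ 0 <= K, K <= 2 * phi w, `|w| * K <= phi w &
      1 <= `|w| -> `|w| * phi w <= (1 + `|w| ^+ 2) * K]].
Proof.
have [D mD [K_E J_E subD U_E]] := gaussian_tail_set w.
have [ik kDE] := kE D mD; have [ikT _] := kE setT measurableT.
have {U_E} [U1 U2] := U_E k ikT k_int0.
have p0 := @normal_pdf01_gt0 R w.
have pn : phi w != 0 by rewrite gt_eqF.
have iphi := @integrable_normal_pdf01 R D mD.
have inphi := @integrable_norm_normal_pdf01 R D mD.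
have ih := integrable_mul_normal_pdf01 h a ch ha D mD.
exists (gauss_tail `|w|), (\int[mu]_(x in D) (h x * phi x)); split.
- rewrite /stein_sol normrM normfV (gtr0_norm p0) divfK// /stein_primitive U1.
  rewrite addrC -K_E -J_E -RintegralD// -RintegralZl//; last exact: lebesgue_integrableD.
  apply: lebesgue_norm_Rintegral_le => //.
  + by apply: lebesgue_integrableZ => //; exact: lebesgue_integrableD.
  + move=> x _; rewrite /k normrM (ger0_norm (normal_pdf01_ge0 _)).
    have -> : l * (phi x + `|x| * phi x) = l * (`|x| + 1) * phi x by ring.
    by rewrite ler_wpM2r ?normal_pdf01_ge0.
- rewrite /stein_sol' /stein_sol mulrDl mulrA divfK// /stein_primitive U2 kDE K_E.
  by ring.
- by rewrite -K_E; exact: norm_Rintegral_normal_pdf01_le.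
- rewrite -K_E -RintegralZl// -RintegralB//; last exact: lebesgue_integrableZ.
  have id : mu.-integrable D (EFin \o (fun x => h x * phi x - h w * phi x)).
    rewrite (_ : (fun x => h x * phi x - h w * phi x) =
      (fun x => h x * phi x + - h w * phi x)); last by apply/funext => x; ring.
    by apply: lebesgue_integrableD => //; exact: lebesgue_integrableZ.
  rewrite -J_E -RintegralZl// -RintegralB//; last exact: lebesgue_integrableZ.
  rewrite -RintegralZl//; last first.
    rewrite (_ : (fun x => `|x| * phi x - `|w| * phi x) =
      (fun x => `|x| * phi x + - `|w| * phi x)); last by apply/funext => x; ring.
    by apply: lebesgue_integrableD => //; exact: lebesgue_integrableZ.
  apply: lebesgue_norm_Rintegral_le => //.
  + apply: lebesgue_integrableZ => //.
    rewrite (_ : (fun x => `|x| * phi x - `|w| * phi x) =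
      (fun x => `|x| * phi x + - `|w| * phi x)); last by apply/funext => x; ring.
    by apply: lebesgue_integrableD => //; exact: lebesgue_integrableZ.
  + move=> x /subD xw; rewrite -!mulrBl normrM (ger0_norm (normal_pdf01_ge0 _)) mulrA.
    by rewrite ler_wpM2r ?normal_pdf01_ge0// -xw.
- rewrite -[in X in [/\ _, X, _ & _]]normal_pdf01_norm -[in X in [/\ _, _, X & _]]normal_pdf01_norm.
  rewrite -[in X in [/\ _, _, _ & X]]normal_pdf01_norm.
  split; [exact: gauss_tail_ge0|exact: gauss_tail_le2|exact: mul_gauss_tail_le|].
  exact: gauss_tail_ge.
Qed.

(** The constant is 1 from the first moment of the tail plus 2 from its mass. *)
Lemma stein_sol_le w : `|stein_sol w| <= 3 * l.
Proof.
have [K [H [h1 _ _ _ [_ K2 _ _]]]] := tail w.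
have p0 := @normal_pdf01_gt0 R w.
rewrite -(ler_pM2r p0); apply: le_trans h1 _.
have : l * (phi w + K) <= l * (3 * phi w) by rewrite ler_wpM2l//; lra.
lra.
Qed.

(** Three pieces of g' phi cost a phi, a (phi - |w| K) and a |w| K, which add up to 2 a phi; |w| K
    <= phi removes the absolute value in the middle one. *)
Lemma stein_sol'_le w : `|stein_sol' w| <= 2 * a.
Proof.
have [K [H [_ h1 hH _ [K0 _ wK _]]]] := tail w.
have p0 := @normal_pdf01_gt0 R w.
rewrite -(ler_pM2r p0) -[X in _ * X <= _](gtr0_norm p0) -normrM h1.
have -> : phi w * (h w - N) - `|w| * (H - N * K) =
  phi w * h w - N * (phi w - `|w| * K) - `|w| * H by ring.
apply: le_trans (ler_normB _ _) _.
have A1 : `|phi w * h w - N * (phi w - `|w| * K)| <= phi w * a + a * (phi w - `|w| * K).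
  apply: le_trans (ler_normB _ _) _; rewrite !normrM (gtr0_norm p0) lerD//.
    by rewrite ler_wpM2l// ltW.
  by rewrite [X in _ * X]ger0_norm ?subr_ge0// ler_wpM2r// subr_ge0.
have A2 : `| `|w| * H| <= `|w| * (a * K) by rewrite normrM normr_id ler_wpM2l.
lra.
Qed.

(** Decay of g' from the Lipschitz bound. Centering [H] at h(w) K makes both pieces of g' phi
    proportional to phi - |w| K, which the lower Mills bound shows to be at most phi / w^2. *)
Lemma stein_sol'_sqr_le w : 3 <= w ^+ 2 ->
  (w ^+ 2 - 3) * `|stein_sol' w| <= 9 / 4 * l * `|w|.
Proof.
move=> w3; have [K [H [_ h1 _ hH [K0 _ wK mills]]]] := tail w.
have p0 := @normal_pdf01_gt0 R w; set p := phi w in p0 h1 hH wK mills *.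
set v := `|w| in h1 hH wK mills *.
have v2 : v ^+ 2 = w ^+ 2 by rewrite real_normK ?num_real.
have v0 : 0 <= v by exact: normr_ge0.
have v1 : 1 <= v by rewrite -(ler_sqr (x := 1)) ?nnegrE// v2; lra.
have {}mills := mills v1.
have B1 : `|stein_sol' w| * p <= l * (p - v * K) * (2 * v + 1).
  rewrite -{1}(gtr0_norm p0) -normrM h1.
  have -> : p * (h w - N) - v * (H - N * K) =
    (p - v * K) * (h w - N) - v * (H - h w * K) by ring.
  apply: le_trans (ler_normB _ _) _; rewrite !normrM (ger0_norm v0).
  rewrite (ger0_norm (x := p - v * K)) ?subr_ge0//.
  have C1 : (p - v * K) * `|h w - N| <= (p - v * K) * (l * (v + 1)).
    by rewrite ler_wpM2l ?subr_ge0.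
  have C2 : v * `|H - h w * K| <= v * (l * (p - v * K)) by rewrite ler_wpM2l.
  lra.
have B2 : v ^+ 2 * (p - v * K) <= p.
  have : v * (v * p) <= v * ((1 + v ^+ 2) * K) by rewrite ler_wpM2l.
  lra.
have B3 : v ^+ 2 * `|stein_sol' w| <= l * (2 * v + 1).
  rewrite -(ler_pM2r p0).
  have : v ^+ 2 * (`|stein_sol' w| * p) <= v ^+ 2 * (l * (p - v * K) * (2 * v + 1)).
    by rewrite ler_wpM2l// sqr_ge0.
  have : l * (2 * v + 1) * (v ^+ 2 * (p - v * K)) <= l * (2 * v + 1) * p.
    by rewrite ler_wpM2l// mulr_ge0//; lra.
  lra.
have v20 : 0 < v ^+ 2 by rewrite v2; lra.
rewrite -v2 -(ler_pM2l v20).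
have B4 : (v ^+ 2 - 3) * (v ^+ 2 * `|stein_sol' w|) <= (v ^+ 2 - 3) * (l * (2 * v + 1)).
  by rewrite ler_wpM2l// v2; lra.
(* Any coefficient of v^3 above 2 wins for large v; 9/4 leaves v^2 / 4 - v, which completes to the
   square of v / 2 - 1. *)
have B5 : l * ((v ^+ 2 - 3) * (2 * v + 1)) <= l * (9 / 4 * v ^+ 3).
  rewrite ler_wpM2l// -subr_ge0.
  have -> : 9 / 4 * v ^+ 3 - (v ^+ 2 - 3) * (2 * v + 1) =
    v * ((v / 2 - 1) ^+ 2 + 5) + 3 by field.
  by rewrite addr_ge0// mulr_ge0// addr_ge0// sqr_ge0.
rewrite [leLHS]mulrCA; apply: le_trans B4 _; rewrite mulrCA; apply: le_trans B5 _.
by rewrite le_eqVlt; apply/orP; left; apply/eqP; ring.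
Qed.

Lemma continuous_stein_sol' : continuous stein_sol'.
Proof.
apply: continuous_addR; last by apply: continuous_addR => //; exact: continuous_cstR.
apply: continuous_mulR; first exact: continuous_idR.
move=> x; apply/differentiable_continuous/derivable1_diffP.
by have [] := is_derive_stein_sol x.
Qed.

End gaussian_stein.

(** * Gaussian expectation as an integral against the density *)

Section gauss_expect_density.
Context {R : realType}.
Local Notation mu := (@lebesgue_measure R).
Local Notation phi := (normal_pdf (0 : R) 1).

(** The Radon-Nikodym derivative of the Gaussian law agrees almost everywhere with the density, as
    both have the same integral over every measurable set. *)
Lemma integral_normal_prob01 (h : R -> \bar R) :
  (@normal_prob R 0 1).-integrable setT h ->
  (\int[normal_prob 0 1]_x h x = \int[mu]_x (h x * (phi x)%:E))%E.
Proof.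
move=> ih; have mh := measurable_int _ ih.
rewrite -(Radon_Nikodym_change_of_variables (normal_prob_dominates 0 1))//=.
apply: ae_eq_integral => //.
- apply: emeasurable_funM => //; apply: (measurable_int mu).
  by apply: Radon_Nikodym_integrable; exact: normal_prob_dominates.
- apply: emeasurable_funM => //=; apply/measurableT_comp => //=.
  exact: measurable_normal_pdf.
- apply: ae_eqe_mul2l => /=.
  rewrite Radon_NikodymE//=; first exact: normal_prob_dominates.
  move=> dom; case: cid => /= g [g1 g2 g3].
  apply: integral_ae_eq => //=.
  + by apply/measurableT_comp => //; exact: measurable_normal_pdf.
  + by move=> E _ mE; rewrite -g3.
Qed.

Lemma gauss_expectE (f : R -> R) (sigma a : R) : continuous f ->
  (forall x, `|f x| <= a) ->
  gauss_expect f sigma = \int[mu]_x (f (sigma * x) * phi x).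
Proof.
move=> cf fa.
have cfs : continuous (fun x => f (sigma * x)).
  apply: continuous_compR => //.
  by apply: continuous_mulR; [exact: continuous_cstR|exact: continuous_idR].
rewrite /gauss_expect /Rintegral integral_normal_prob01.
  by congr fine; apply: eq_integral => x _; rewrite EFinM.
apply: (@le_integrable _ _ _ _ _ measurableT _ (EFin \o cst a)) => //.
- by apply/measurable_EFinP; exact: continuous_measurable_fun.
- by move=> x _; rewrite lee_fin /= (le_trans (fa _))// ler_norm.
- exact: finite_measure_integrable_cst.
Qed.

End gauss_expect_density.

(** * Cauchy-Schwarz and the operator bound *)

Section averages.
Context {R : realType} {d n : nat} (hn : (1 <= n)%N).
Implicit Types (u v : 'rV[R]_d).

Lemma dotv_cauchy u v : dotv u v ^+ 2 <= dotv u u * dotv v v.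
Proof.
have [v0|v0] := eqVneq (dotv v v) 0.
  have vE i : v 0 i = 0.
    apply/eqP; rewrite -sqrf_eq0 eq_le sqr_ge0 andbT -v0 /dotv (bigD1 i)//=.
    by rewrite -expr2 lerDl sumr_ge0// => j _; rewrite -expr2 sqr_ge0.
  by rewrite v0 mulr0 {1}/dotv big1 ?expr0n// => i _; rewrite vE mulr0.
have vp : 0 < dotv v v by rewrite lt0r v0 dotv_ge0.
(* The squared norm of this vector is |v|^2 (|u|^2 |v|^2 - <u, v>^2). *)
have := dotv_ge0 (dotv v v *: u + (- dotv u v) *: v).
rewrite dotvDl !dotvZl ![dotv _ (_ + _)]dotvC !dotvDl !dotvZl [dotv v u]dotvC.
set U := dotv u u; set V := dotv v v in vp *; set W := dotv u v => h.
have : 0 <= V * (U * V - W ^+ 2) by move: h; congr (_ <= _); ring.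
by rewrite pmulr_rge0// subr_ge0.
Qed.

(** Nonnegativity of the empirical variance of the |t_i|. *)
Lemma mean_norm_le (t : 'I_n -> R) :
  n%:R^-1 * \sum_(i < n) `|t i| <= Num.sqrt (n%:R^-1 * \sum_(i < n) t i ^+ 2).
Proof.
set s := n%:R^-1 * \sum_(i < n) `|t i|.
have n0 : 0 < n%:R :> R by rewrite ltr0n.
have s0 : 0 <= s by apply: mulr_ge0; [rewrite invr_ge0 ltW|apply: sumr_ge0].
rewrite -[leLHS](ger0_norm s0) -sqrtr_sqr ler_wsqrtr//.
have : 0 <= n%:R^-1 * \sum_(i < n) (`|t i| - s) ^+ 2.
  by apply: mulr_ge0; [rewrite invr_ge0 ltW|apply: sumr_ge0 => i _; exact: sqr_ge0].
have -> : \sum_(i < n) (`|t i| - s) ^+ 2 =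
    \sum_(i < n) t i ^+ 2 - 2 * s * \sum_(i < n) `|t i| + n%:R * s ^+ 2.
  transitivity (\sum_(i < n) (t i ^+ 2 - 2 * s * `|t i| + s ^+ 2)).
    apply: eq_bigr => i _; rewrite sqrrB real_normK ?num_real//.
    by rewrite -mulr_natr; ring.
  by rewrite big_split /= sumrB -mulr_sumr sumr_const card_ord -[_ *+ n]mulr_natl.
have -> : \sum_(i < n) `|t i| = n%:R * s by rewrite /s mulrA divff ?mul1r ?gt_eqF.
set T := \sum_(i < n) t i ^+ 2.
have -> : n%:R^-1 * (T - 2 * s * (n%:R * s) + n%:R * s ^+ 2) = n%:R^-1 * T - s ^+ 2.
  by field; rewrite gt_eqF.
by rewrite subr_ge0.
Qed.

Context (x : 'I_n -> 'rV[R]_d) (B : R).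
Hypothesis hB : forall theta : 'rV[R]_d, @sphere R d theta ->
  n%:R^-1 * \sum_(i < n) dotv theta (x i) ^+ 2 <= B.

Lemma mean_norm_dotv_le theta : @sphere R d theta ->
  n%:R^-1 * \sum_(i < n) `|dotv theta (x i)| <= Num.sqrt B.
Proof.
move=> st; apply: le_trans (mean_norm_le _) _.
by rewrite ler_wsqrtr// hB.
Qed.

(** By duality: the norm of the averaged vector is its inner product with its own direction, a point
    of the sphere where [hB] applies. No norm of a single x_i enters. *)
Lemma mean_comb_le (c : 'I_n -> R) (C : R) : (forall i, `|c i| <= C) ->
  enorm (n%:R^-1 *: \sum_(i < n) c i *: x i) <= C * Num.sqrt B.
Proof.
move=> hc; set X := n%:R^-1 *: _.
have n0 : 0 < n%:R :> R by rewrite ltr0n.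
have C0 : 0 <= C by exact: le_trans (normr_ge0 _) (hc (Ordinal hn)).
have [X0|X0] := eqVneq (enorm X) 0; first by rewrite X0 mulr_ge0 ?sqrtr_ge0.
have Xp : 0 < enorm X by rewrite lt0r X0 sqrtr_ge0.
have XX : enorm X ^+ 2 = dotv X X by rewrite sqr_sqrtr// dotv_ge0.
set th := (enorm X)^-1 *: X.
have sth : @sphere R d th.
  by rewrite sphereE /= /th dotvZl dotvC dotvZl -XX; field.
have -> : enorm X = n%:R^-1 * \sum_(i < n) c i * dotv th (x i).
  transitivity (dotv X th).
    by rewrite dotvC /th dotvZl -XX expr2 mulrA mulVf// mul1r.
  rewrite {1}/X dotvZl dotv_suml; congr (_ * _); apply: eq_bigr => i _.
  by rewrite dotvZl dotvC.
apply: (@le_trans _ _ (C * (n%:R^-1 * \sum_(i < n) `|dotv th (x i)|))).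
  rewrite mulrCA; apply: ler_wpM2l; first by rewrite invr_ge0 ltW.
  rewrite mulr_sumr; apply: ler_sum => i _.
  by rewrite (le_trans (ler_norm _))// normrM ler_wpM2r.
by rewrite ler_wpM2l// mean_norm_dotv_le.
Qed.

(** The left-hand side pairs v with the projection of u orthogonal to theta, and projecting does not
    increase the norm. *)
Lemma dotv_tangent_le theta u v (a b : R) : @sphere R d theta ->
  enorm u <= a -> enorm v <= b ->
  `|dotv u v - dotv theta u * dotv theta v| <= a * b.
Proof.
rewrite sphereE /= => st ua vb.
have a0 : 0 <= a := le_trans (sqrtr_ge0 _) ua.
have b0 : 0 <= b := le_trans (sqrtr_ge0 _) vb.
set w := u + (- dotv theta u) *: theta.
have wv : dotv w v = dotv u v - dotv theta u * dotv theta v.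
  by rewrite dotvDl dotvZl mulNr.
have ww : dotv w w <= dotv u u.
  rewrite dotvDl dotvZl ![dotv _ w]dotvC !dotvDl !dotvZl [dotv u theta]dotvC st.
  set t := dotv theta u; rewrite -subr_ge0.
  have -> : dotv u u - (dotv u u + - t * t + - t * (t + - t * 1)) = t ^+ 2 by ring.
  exact: sqr_ge0.
rewrite -wv -sqrtr_sqr; apply: (@le_trans _ _ (Num.sqrt (dotv u u * dotv v v))).
  by rewrite ler_wsqrtr// (le_trans (dotv_cauchy _ _))// ler_wpM2r// dotv_ge0.
by rewrite sqrtrM ?dotv_ge0// ler_pM// sqrtr_ge0.
Qed.

End averages.

(** * Gronwall's inequality and an elementary estimate *)

Section gronwall.
Context {R : realType}.

(** Multiplied by exp(- (al s + be s^2 / 2)), m becomes nonincreasing on [0, t]. *)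
Lemma gronwall_quadratic (m m' : R -> R) (al be t : R) : 0 <= t ->
  (forall s : R, is_derive s (1 : R) m (m' s)) ->
  (forall s : R, 0 <= s -> m' s <= (al + be * s) * m s) ->
  m t <= m 0 * expR (al * t + be * t ^+ 2 / 2).
Proof.
move=> t0 dm hm.
pose e (s : R) := expR (- (al * s + be * s ^+ 2 / 2)).
have de (s : R) : is_derive s (1 : R) e (- (al + be * s) * e s).
  by apply: is_derive_eq; rewrite /GRing.scale /=; rewrite /e; field.
have dq (s : R) : is_derive s (1 : R) (fun s => m s * e s) ((m' s - (al + be * s) * m s) * e s).
  apply: is_derive_eq (is_deriveM (dm s) (de s)) _.
  by rewrite /GRing.scale /=; ring.
have : m t * e t <= m 0 * e 0.
  apply: (@ler0_derive1_le_cc R (fun s => m s * e s) 0 t) => //.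
  - move=> s; rewrite in_itv /= => /andP[s0 _].
    rewrite derive1E; have [_ ->] := dq s.
    by rewrite mulr_le0_ge0 ?expR_ge0// subr_le0 hm// ltW.
  - apply: continuous_subspaceT => s.
    apply/differentiable_continuous/derivable1_diffP.
    by have [] := dq s.
  - by rewrite in_itv /= t0 lexx.
  - by rewrite in_itv /= lexx t0.
rewrite {2}/e mulr0 expr0n /= mulr0 mul0r addr0 oppr0 expR0 mulr1 /e expRN => h.
by rewrite -ler_pdivrMr ?expR_gt0.
Qed.

End gronwall.

(** Used with w2 = w^2 and v = |g'(w)|. Below 3 the factor |w2 - 1| is at most 2; above, it is (w2 -
    3) + 2, and decay handles the first summand. *)
Lemma norm_mul_sqr_sub1_le {R : realType} (w2 v a c : R) : 0 <= w2 -> 0 <= v ->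
  v <= 2 * a -> 0 <= c -> (3 <= w2 -> (w2 - 3) * v <= c) ->
  v * `|w2 - 1| <= 4 * a + c.
Proof.
move=> w0 v0 va c0 h; have [w3|w3] := leP 3 w2.
  have hc := h w3; rewrite (ger0_norm (x := w2 - 1)); lra.
have h1 : `|w2 - 1| <= 2 by rewrite ler_norml; lra.
by apply: (@le_trans _ _ (2 * a * 2)); [rewrite ler_pM|lra].
Qed.

(** * Exponential moments and upper tail for a function of class C^1 *)

Section smooth_concentration.
Context {R : realType} {d n : nat} (hd : (2 <= d)%N) (hn : (1 <= n)%N).
Context (x : 'I_n -> 'rV[R]_d) (sigma : R) (hsigma : 0 < sigma).
Context (A B : R) (B0 : 0 < B).
Hypothesis hA : n%:R^-1 * \sum_(i < n) `|sigma ^- 2 * enorm (x i) ^+ 2 - d%:R| <= A.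
Hypothesis hB : forall theta : 'rV[R]_d, @sphere R d theta ->
  n%:R^-1 * \sum_(i < n) dotv theta (x i) ^+ 2 <= B.
Context (P : probability (RdBorel R d) R) (hP : uniform_on_sphere P).
Context (f f' : R -> R) (a b : R) (b0 : 0 < b) (ab1 : a + b = 1).
Hypothesis (df : forall t : R, is_derive t (1 : R) f (f' t)) (cf' : continuous f').
Hypothesis (fa : forall t, `|f t| <= a) (fb : forall t, `|f' t| <= b).

Let cf : continuous f.
Proof.
move=> t; apply/differentiable_continuous/derivable1_diffP.
by have [] := df t.
Qed.

Let n0 : 0 < n%:R :> R. Proof. by rewrite ltr0n. Qed.
Let a0 : 0 <= a. Proof. exact: le_trans (normr_ge0 _) (fa 0). Qed.

Lemma lipschitz_of_derive_le s t : `|f s - f t| <= b * `|s - t|.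
Proof.
wlog ts : s t / t <= s.
  move=> hw; have [ts|/ltW st] := leP t s; first exact: hw.
  by rewrite distrC [`|s - t|]distrC; exact: hw.
have [c _ ->] := @MVT_segment R f f' t s ts (fun z _ => df z) (continuous_subspaceT cf).
by rewrite normrM ler_wpM2r.
Qed.

Let h (w : R) := f (sigma * w).
Let N := gauss_expect f sigma.
Let g := stein_sol h.
Let g' := stein_sol' h.
Let l := b * sigma.
Let y i := sigma^-1 *: x i.

Let ch : continuous h.
Proof.
apply: continuous_compR => //.
by apply: continuous_mulR; [exact: continuous_cstR|exact: continuous_idR].
Qed.

Let ha w : `|h w| <= a. Proof. exact: fa. Qed.

Let hl s t : `|h s - h t| <= l * `|s - t|.
Proof.
apply: le_trans (lipschitz_of_derive_le _ _) _.
by rewrite -mulrBr normrM (gtr0_norm hsigma) mulrA.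
Qed.

Let NE : N = \int[@lebesgue_measure R]_z (h z * normal_pdf (0 : R) 1 z).
Proof. exact: gauss_expectE cf fa. Qed.

Let g'E w : g' w = w * g w + (h w - N).
Proof. by rewrite /g' /stein_sol' NE. Qed.

Let dg w : is_derive w (1 : R) g (g' w).
Proof. exact: is_derive_stein_sol ch ha w. Qed.

Let cg' : continuous g'.
Proof. exact: continuous_stein_sol' ch ha. Qed.

Let F (u : 'rV[R]_d) := empirical_integral x u f.

Let hyE u i : h (dotv u (y i)) = f (dotv u (x i)).
Proof.
by rewrite /h /y [dotv u _]dotvC dotvZl mulrA divff ?gt_eqF// mul1r dotvC.
Qed.

Section exponential.
Context (s : R).

Let psi u := expR (s * (F u - N)).
(** The gradient of [F] at u. *)
Let X u : 'rV[R]_d := n%:R^-1 *: \sum_(i < n) f' (dotv u (x i)) *: x i.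

Lemma smooth_grad_exp_mean : smooth_grad psi (fun u => (s * psi u) *: X u).
Proof.
have := smooth_grad_sum n _ _ (fun i =>
  smooth_grad_comp _ _ f f' (smooth_grad_dotv (x i)) df cf').
set S := fun u => \sum_(i < n) f (dotv u (x i)).
pose E (t : R) := expR (s * (n%:R^-1 * t - N)).
have dE (t : R) : is_derive t (1 : R) E (s * n%:R^-1 * E t).
  by apply: is_derive_eq; rewrite /GRing.scale /E /=; ring.
have cE : continuous (fun t => s * n%:R^-1 * E t).
  apply: continuous_mulR; first exact: continuous_cstR.
  move=> t; apply/differentiable_continuous/derivable1_diffP.
  by have [] := dE t.
move=> /(smooth_grad_comp _ _ E _) /(_ dE cE).
congr (smooth_grad _ _); apply/funext => u.
by rewrite /X scalerA mulrAC.
Qed.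

Let W u i := dotv u (y i).
Let r i := dotv (y i) (y i).
Let D : R := d%:R - 1.
(** What integration by parts makes of D (g'(W) - W g(W)) under the weight [psi]: D g' minus the
    tangential derivative of g(W) psi along y_i, divided by psi. *)
Let t u i := g' (W u i) * (D - r i + W u i ^+ 2) -
  s * g (W u i) * (dotv (y i) (X u) - W u i * dotv u (X u)).

Let WE u i : W u i = sigma^-1 * dotv u (x i).
Proof. by rewrite /W /y dotvC dotvZl dotvC. Qed.

Let g'_bound w : `|g' w| * `|w ^+ 2 - 1| <= 4 * a + 9 / 4 * l * `|w|.
Proof.
apply: norm_mul_sqr_sub1_le; rewrite ?sqr_ge0//.
- exact: stein_sol'_le.
- by apply: mulr_ge0 => //; apply: mulr_ge0 => //; apply: mulr_ge0 => //; exact: ltW.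
- exact: stein_sol'_sqr_le.
Qed.

(** The factor A + 2 is the thin-shell contribution 2 a A plus the 4 a left by |g'| |W^2 - 1|. The
    term linear in s is the product of the norm bounds 3 b sqrt B and b sqrt B. *)
Let t_le u : 0 <= s -> @sphere R d u -> n%:R^-1 * \sum_(i < n) t u i <=
  2 * a * (A + 2) + 9 / 4 * (b * Num.sqrt B) + 3 * b ^+ 2 * B * s.
Proof.
move=> s0 su; rewrite sumrB mulrBr.
have mean_le := mean_norm_dotv_le hn x B hB u su.
have T1 : n%:R^-1 * \sum_(i < n) g' (W u i) * (D - r i + W u i ^+ 2) <=
    2 * a * (A + 2) + 9 / 4 * (b * Num.sqrt B).
  apply: (@le_trans _ _ (n%:R^-1 * \sum_(i < n)
     (2 * a * `|sigma ^- 2 * enorm (x i) ^+ 2 - d%:R| + (4 * a + 9 / 4 * b * `|dotv u (x i)|)))).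
    apply: ler_wpM2l; first by rewrite invr_ge0 ltW.
    apply: ler_sum => i _; apply: (le_trans (ler_norm _)); rewrite normrM.
    (* As D = d - 1, this separates the thin-shell error of x_i from the deviation of W^2 from 1. *)
    have -> : D - r i + W u i ^+ 2 = - (sigma ^- 2 * enorm (x i) ^+ 2 - d%:R) + (W u i ^+ 2 - 1).
      rewrite /D /r /y dotvZl dotvC dotvZl /enorm sqr_sqrtr ?dotv_ge0//.
      by field; rewrite gt_eqF.
    apply: (@le_trans _ _ (`|g' (W u i)| * (`|sigma ^- 2 * enorm (x i) ^+ 2 - d%:R| + `|W u i ^+ 2 - 1|))).
      by apply: ler_wpM2l => //; rewrite (le_trans (ler_normD _ _))// normrN.
    rewrite mulrDr; apply: lerD.
      by apply: ler_wpM2r => //; exact: stein_sol'_le.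
    apply: (le_trans (g'_bound _)); rewrite lerD2l.
    rewrite WE normrM gtr0_norm ?invr_gt0// /l.
    by rewrite le_eqVlt; apply/orP; left; apply/eqP; field; rewrite gt_eqF.
  rewrite !big_split /= -!mulr_sumr sumr_const card_ord -[a *+ n]mulr_natl.
  set SA := \sum_(i < n) _; set SB := \sum_(i < n) `|dotv u (x i)|.
  have -> : n%:R^-1 * (2 * a * SA + (4 * (n%:R * a) + 9 / 4 * b * SB)) =
    2 * a * (n%:R^-1 * SA) + 4 * a + 9 / 4 * b * (n%:R^-1 * SB) by field; rewrite gt_eqF.
  have : 2 * a * (n%:R^-1 * SA) <= 2 * a * A.
    by apply: ler_wpM2l => //; rewrite mulr_ge0.
  have : 9 / 4 * b * (n%:R^-1 * SB) <= 9 / 4 * b * Num.sqrt B.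
    by apply: ler_wpM2l => //; rewrite mulr_ge0// ltW.
  lra.
(* The mean over i is taken before any absolute value, so that two averaged vectors are paired and
   the operator bound applies to each of them. *)
pose Y := n%:R^-1 *: \sum_(i < n) (sigma^-1 * g (W u i)) *: x i.
have T2E : n%:R^-1 * \sum_(i < n) s * g (W u i) * (dotv (y i) (X u) - W u i * dotv u (X u)) =
    s * (dotv Y (X u) - dotv u Y * dotv u (X u)).
  rewrite [dotv u Y]dotvC /Y !dotvZl !dotv_suml.
  under [in RHS]eq_bigr do rewrite dotvZl.
  under [X in _ = s * (_ - _ * X * _)]eq_bigr do rewrite dotvZl.
  rewrite -mulrA -mulrBr mulrCA; congr (_ * _); rewrite mulr_suml -sumrB mulr_sumr.
  apply: eq_bigr => i _; rewrite WE /y dotvZl [dotv (x i) u]dotvC.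
  by ring.
have T2 : `|dotv Y (X u) - dotv u Y * dotv u (X u)| <= (3 * b * Num.sqrt B) * (b * Num.sqrt B).
  apply: dotv_tangent_le => //.
    apply: (mean_comb_le hn x B hB) => i; rewrite normrM gtr0_norm ?invr_gt0//.
    rewrite mulrC ler_pdivrMr//; have := stein_sol_le h a l ch ha hl (W u i).
    by rewrite /l mulrA.
  exact: (mean_comb_le hn x B hB).
rewrite T2E; apply: lerD => //.
have -> : 3 * b ^+ 2 * B * s = s * ((3 * b * Num.sqrt B) * (b * Num.sqrt B)).
  by rewrite -{1}(sqr_sqrtr (ltW B0)); ring.
by rewrite -mulrN; apply: ler_wpM2l => //; rewrite (le_trans (ler_norm _))// normrN.
Qed.

Lemma mgf_derive_le : 0 <= s ->
  D * sE P (fun u => (F u - N) * psi u) <=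
  (2 * a * (A + 2) + 9 / 4 * (b * Num.sqrt B) + 3 * b ^+ 2 * B * s) * sE P psi.
Proof.
move=> s0.
have hpsi := smooth_grad_exp_mean.
have cpsi : continuous psi by have [] := hpsi.
have cW i : continuous (W^~ i) by exact: continuous_dotv.
have cgW i : continuous (fun u => g (W u i)).
  apply: continuous_compR => // w; apply/differentiable_continuous/derivable1_diffP.
  by have [] := dg w.
have cg'W i : continuous (fun u => g' (W u i)) by exact: continuous_compR.
have cX v : continuous (fun u => dotv v (X u)).
  under eq_fun do rewrite dotvC dotvZl dotv_suml.
  apply: continuous_mulR; first exact: continuous_cstR.
  apply: continuous_sumR => k; under eq_fun do rewrite dotvZl.
  apply: continuous_mulR; last exact: continuous_cstR.
  by apply: continuous_compR => //; exact: continuous_dotv.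
have cuX : continuous (fun u => dotv u (X u)).
  under eq_fun do rewrite dotvC dotvZl dotv_suml.
  apply: continuous_mulR; first exact: continuous_cstR.
  apply: continuous_sumR => k; under eq_fun do rewrite dotvZl [dotv (x k) _]dotvC.
  by apply: continuous_mulR; [apply: continuous_compR => //|]; exact: continuous_dotv.
have ct i : continuous (t^~ i).
  apply: continuous_addR.
    apply: continuous_mulR => //; apply: continuous_addR; first exact: continuous_cstR.
    by apply: continuous_mulR.
  apply: continuous_oppR; apply: continuous_mulR.
    by apply: continuous_mulR => //; exact: continuous_cstR.
  by apply: continuous_addR => //; apply: continuous_oppR; apply: continuous_mulR.
(* Integration by parts in the direction y_i for the function g(W_i) psi. *)
have key i : D * sE P (fun u => (g' (W u i) - W u i * g (W u i)) * psi u) =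
    sE P (fun u => psi u * t u i).
  have := sE_ibp P hP _ _ (y i) (smooth_gradM _ _ _ _
    (smooth_grad_comp _ _ g g' (smooth_grad_dotv (y i)) dg cg') hpsi).
  rewrite -/D => ibp.
  have -> : sE P (fun u => (g' (W u i) - W u i * g (W u i)) * psi u) =
      sE P (fun u => g' (W u i) * psi u) - sE P (fun u => W u i * (g (W u i) * psi u)).
    rewrite -mulN1r -sEZ//; last by do 2! apply: continuous_mulR => //.
    rewrite -sED//; last 2 first.
    - exact: continuous_mulR.
    - by apply: continuous_mulR; [exact: continuous_cstR|do 2! apply: continuous_mulR => //].
    by apply: eq_sE => u _; ring.
  have cgp : continuous (fun u => g' (W u i) * psi u) by exact: continuous_mulR.
  pose q u := psi u * (s * g (W u i) * (dotv (y i) (X u) - W u i * dotv u (X u)) +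
     g' (W u i) * (r i - W u i ^+ 2)).
  have cq : continuous q.
    apply: continuous_mulR => //; apply: continuous_addR.
      apply: continuous_mulR; first by apply: continuous_mulR => //; exact: continuous_cstR.
      by apply: continuous_addR => //; apply: continuous_oppR; apply: continuous_mulR.
    apply: continuous_mulR => //; apply: continuous_addR; first exact: continuous_cstR.
    by apply: continuous_oppR; apply: continuous_mulR.
  have ibpq : D * sE P (fun u => W u i * (g (W u i) * psi u)) = sE P q.
    rewrite ibp; apply: eq_sE => u _.
    by rewrite /q /r /W; move: (y i) (X u) => Y X'; rewrite !dotvDr !dotvZr; ring.
  rewrite mulrBr ibpq -sEZ//.
  rewrite -mulN1r -sEZ// -sED//; last 2 first.
  - by apply: continuous_mulR => //; exact: continuous_cstR.
  - by apply: continuous_mulR => //; exact: continuous_cstR.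
  by apply: eq_sE => u _; rewrite /q /t; ring.
have -> : sE P (fun u => (F u - N) * psi u) = n%:R^-1 *
    \sum_(i < n) sE P (fun u => (g' (W u i) - W u i * g (W u i)) * psi u).
  have cc i : continuous (fun u => (g' (W u i) - W u i * g (W u i)) * psi u).
    apply: continuous_mulR => //; apply: continuous_addR => //.
    by apply: continuous_oppR; apply: continuous_mulR.
  rewrite -sE_sum// -sEZ; last exact: continuous_sumR.
  apply: eq_sE => u _; rewrite -mulr_suml mulrA; congr (_ * _).
  (* The Stein equation is used here, separately at each W_i. *)
  transitivity (n%:R^-1 * \sum_(i < n) (f (dotv u (x i)) - N)).
    rewrite sumrB sumr_const card_ord -[N *+ n]mulr_natl mulrBr.
    by rewrite [n%:R^-1 * (n%:R * N)]mulrA mulVf ?gt_eqF// mul1r.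
  by congr (_ * _); apply: eq_bigr => i _; rewrite g'E -hyE /W; ring.
rewrite mulrCA mulr_sumr; under eq_bigr do rewrite key.
have cpt i : continuous (fun u => psi u * t u i) by exact: continuous_mulR.
have csum : continuous (fun u => \sum_(i < n) psi u * t u i) by exact: continuous_sumR.
rewrite -sE_sum// -sEZ//.
rewrite -sEZ//; apply: sE_le => //.
- by apply: continuous_mulR => //; exact: continuous_cstR.
- by apply: continuous_mulR => //; exact: continuous_cstR.
- move=> u su; rewrite -mulr_sumr mulrCA [leRHS]mulrC; apply: ler_wpM2l; first exact: expR_ge0.
  exact: t_le.
Qed.

End exponential.

Let D : R := d%:R - 1.
Let D1 : 1 <= D.
Proof. by rewrite /D lerBrDr (_ : 1 + 1 = 2%:R)// ler_nat. Qed.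

Let cF : continuous F.
Proof.
apply: continuous_mulR; first exact: continuous_cstR.
by apply: continuous_sumR => i; apply: continuous_compR => //; exact: continuous_dotv.
Qed.

Let cFN : continuous (fun u => F u - N).
Proof. by apply: continuous_addR => //; exact: continuous_cstR. Qed.

Let cpsi (s : R) : continuous (fun u => expR (s * (F u - N))).
Proof. by have [] := smooth_grad_exp_mean s. Qed.

Let m (s : R) := sE P (fun u => expR (s * (F u - N))).
Let m' (s : R) := sE P (fun u => (F u - N) * expR (s * (F u - N))).

Let dm (s : R) : is_derive s (1 : R) m (m' s).
Proof.
have [C C0 hC] := continuous_sphere_bound _ cFN.
(* On the window |r - s| < 1 the exponent is at most (|s| + 1) C, where C bounds |F - N| on the
   sphere. *)
apply: (@sE_derive _ _ P (fun s u => expR (s * (F u - N)))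
  (fun s u => (F u - N) * expR (s * (F u - N))) s (C * expR ((`|s| + 1) * C))).
- exact: cpsi.
- move=> r u _; apply: is_derive_eq.
  by rewrite /GRing.scale /=; ring.
- move=> r u rs su; rewrite normrM; apply: ler_pM => //; first exact: hC.
  rewrite (ger0_norm (expR_ge0 _)) ler_expR.
  apply: (le_trans (ler_norm _)); rewrite normrM; apply: ler_pM => //; last exact: hC.
  rewrite -[r](subrK s); apply: (le_trans (ler_normD _ _)); rewrite addrC lerD2l.
  exact: ltW.
Qed.

Lemma mgf_le (s : R) : 0 <= s ->
  m s <= expR ((2 * a * (A + 2) + 9 / 4 * (b * Num.sqrt B)) / D * s +
    3 * b ^+ 2 * B / D * s ^+ 2 / 2).
Proof.
move=> s0; have D0 : 0 < D by exact: lt_le_trans D1.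
have m0 : m 0 = 1.
  by rewrite /m -[RHS](sE_cst P hP); apply: eq_sE => u _; rewrite mul0r expR0.
apply: le_trans (gronwall_quadratic m m' _ _ s s0 dm _) _; last by rewrite m0 mul1r.
move=> r r0; rewrite -(ler_pM2l D0).
apply: le_trans (mgf_derive_le r r0) _.
by rewrite le_eqVlt; apply/orP; left; apply/eqP; rewrite /m; field; rewrite gt_eqF.
Qed.

(** The bound does not contain b: b tau is the part of eps beyond the drift, and the quadratic
    coefficient is proportional to b^2. *)
Lemma smooth_upper_tail (eps : R) : 2 * (A + 2) / D <= eps ->
  9 / 4 * (Num.sqrt B / Num.sqrt D) < eps ->
  (P [set u | (eps < F u - N)%R] <=
   (expR (- (D * (eps - 9 / 4 * (Num.sqrt B / Num.sqrt D)) ^+ 2 / (6 * B))))%:E)%E.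
Proof.
move=> e1 e2; have D0 : 0 < D by exact: lt_le_trans D1.
set tau := eps - _; have tau0 : 0 < tau by rewrite subr_gt0.
(* Minimizer of - b tau s + 3 b^2 B s^2 / (2 D), with minimum - D tau^2 / (6 B). *)
pose s := D * tau / (3 * b * B).
have s0 : 0 < s by rewrite /s divr_gt0 ?mulr_gt0.
have -> : [set u | (eps < F u - N)%R] = [set u | (s * eps < s * (F u - N))%R].
  by apply/seteqP; split=> u /=; rewrite ltr_pM2l.
have csF : continuous (fun u => s * (F u - N)).
  by apply: continuous_mulR => //; exact: continuous_cstR.
apply: le_trans (sE_chernoff P hP _ (s * eps) csF) _.
rewrite lee_fin.
have -> : sE P (fun u => expR (s * (F u - N) - s * eps)) = expR (- (s * eps)) * m s.
  by rewrite /m -sEZ//; apply: eq_sE => u _; rewrite expRD mulrC.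
apply: (@le_trans _ _ (expR (- (s * eps)) *
   expR ((2 * a * (A + 2) + 9 / 4 * (b * Num.sqrt B)) / D * s +
    3 * b ^+ 2 * B / D * s ^+ 2 / 2))).
  by apply: ler_wpM2l; [exact: expR_ge0|exact/mgf_le/ltW].
rewrite -expRD ler_expR.
have q1 : 2 * a * (A + 2) / D <= a * eps.
  have -> : 2 * a * (A + 2) / D = a * (2 * (A + 2) / D) by ring.
  exact: ler_wpM2l.
have sD0 : 0 < Num.sqrt D by rewrite sqrtr_gt0.
have sD : Num.sqrt D <= D.
  have sD1 : 1 <= Num.sqrt D by rewrite -sqrtr1 ler_wsqrtr.
  by rewrite -[leRHS](sqr_sqrtr (ltW D0)) expr2 ler_peMl// ltW.
have q2 : b * Num.sqrt B / D <= b * (Num.sqrt B / Num.sqrt D).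
  rewrite -mulrA; apply: ler_wpM2l; first exact: ltW.
  by apply: ler_wpM2l; [exact: sqrtr_ge0|rewrite lef_pV2].
(* The thin-shell term uses up a eps; as a + b = 1, the remaining b eps exceeds b tau by exactly the
   9/4 term. *)
have q3 : (2 * a * (A + 2) + 9 / 4 * (b * Num.sqrt B)) / D <= eps - b * tau.
  have -> : (2 * a * (A + 2) + 9 / 4 * (b * Num.sqrt B)) / D =
    2 * a * (A + 2) / D + 9 / 4 * (b * Num.sqrt B / D) by ring.
  have -> : eps - b * tau = a * eps + 9 / 4 * (b * (Num.sqrt B / Num.sqrt D)).
    by rewrite /tau -[X in X - _](mul1r eps) -{1}ab1; ring.
  by apply: lerD => //; apply: ler_wpM2l.
have q4 : (2 * a * (A + 2) + 9 / 4 * (b * Num.sqrt B)) / D * s <= (eps - b * tau) * s.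
  by apply: ler_wpM2r => //; exact: ltW.
apply: (@le_trans _ _ (- (s * eps) + ((eps - b * tau) * s + 3 * b ^+ 2 * B / D * s ^+ 2 / 2))).
  by rewrite lerD2l lerD2r.
rewrite le_eqVlt; apply/orP; left; apply/eqP; rewrite /s; field.
by rewrite !gt_eqF.
Qed.

End smooth_concentration.

(** * Primitives and approximation by functions of class C^1 *)

Section smoothing.
Context {R : realType}.
Local Notation mu := (@lebesgue_measure R).
Local Notation phi := (normal_pdf (0 : R) 1).

(* The bound of [f] by a multiple of the Gaussian density on [-oo, u] makes the
   fundamental theorem of calculus available on the whole line. *)
Lemma primitive_of_vanishing (f : R -> R) (a : R) : continuous f ->
  (forall x, `|f x| <= a) -> (forall x, x <= 0 -> f x = 0) ->
  exists Phi : R -> R, forall x : R, is_derive x (1 : R) Phi (f x).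
Proof.
move=> cf fa f0; exists (fun x => \int[mu]_(t in `]-oo, x]) f t) => x.
have a0 : 0 <= a := le_trans (normr_ge0 _) (fa 0).
pose u := `|x| + 1.
have xu : x < u by rewrite /u (le_lt_trans (ler_norm _))// ltrDl.
have u0 : 0 <= u by rewrite addr_ge0.
have pu := @normal_pdf01_gt0 R u.
have fi : mu.-integrable `]-oo, u] (EFin \o f).
  have := integrable_cst_normal_pdf01 (a / phi u) `]-oo, u]%classic (measurable_itv _).
  apply: le_integrable => //.
  - by apply/measurable_EFinP; apply: measurable_funTS; exact: continuous_measurable_fun.
  - move=> t /=; rewrite in_itv /= => tu; rewrite lee_fin.
    rewrite (ger0_norm (x := _ * _)); last first.
      by rewrite mulr_ge0 ?normal_pdf01_ge0// divr_ge0// ltW.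
    have [t0|t0] := leP t 0.
      by rewrite f0// normr0 mulr_ge0 ?normal_pdf01_ge0// divr_ge0// ltW.
    apply: (le_trans (fa t)); rewrite mulrAC ler_pdivlMr// ler_wpM2l//.
    by rewrite normal_pdf01_le// (ltW t0).
have [dU dE] := @continuous_FTC1 R f (BInfty R true) x u xu fi (ltNyr x) (cf x).
by split; [exact: dU|rewrite -derive1E; exact: dE].
Qed.

Let continuous_max0 : continuous (fun x : R => Num.max x 0).
Proof. by move=> x; apply: (@continuous_max R R id (cst 0)); [exact: cvg_id|exact: cvg_cst]. Qed.

(** f - f(0) is cut at 0; each half, the left one after reflection, vanishes on the negative axis.
    The constant f(0) adds a linear term. *)
Lemma exists_primitive (f : R -> R) (a : R) : continuous f ->
  (forall x, `|f x| <= a) ->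
  exists Phi : R -> R, forall x : R, is_derive x (1 : R) Phi (f x).
Proof.
move=> cf fa.
pose fp x := f (Num.max x 0) - f 0.
pose fm x := f (- Num.max x 0) - f 0.
have cN : continuous (fun x : R => - Num.max x 0) by exact: continuous_oppR.
have [Phip dp] : exists Phi : R -> R, forall x : R, is_derive x (1 : R) Phi (fp x).
  apply: (@primitive_of_vanishing _ (a + a)).
  - by apply: continuous_addR; [exact: continuous_compR|exact: continuous_cstR].
  - by move=> x; apply: (le_trans (ler_normB _ _)); apply: lerD.
  - by move=> x x0; rewrite /fp max_r// subrr.
have [Phim dm] : exists Phi : R -> R, forall x : R, is_derive x (1 : R) Phi (fm x).
  apply: (@primitive_of_vanishing _ (a + a)).
  - by apply: continuous_addR; [exact: continuous_compR|exact: continuous_cstR].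
  - by move=> x; apply: (le_trans (ler_normB _ _)); apply: lerD.
  - by move=> x x0; rewrite /fm max_r// oppr0 subrr.
exists (fun x => f 0 * x + (Phip x - Phim (- x))) => x.
have dx := dp x; have dmx := dm (- x).
apply: is_derive_eq; rewrite /GRing.scale /= /fp /fm.
have [x0|/ltW x0] := leP x 0.
  by rewrite max_l ?oppr_ge0// opprK; ring.
by rewrite max_r ?oppr_le0// oppr0; ring.
Qed.

(** The difference quotient of a primitive equals f at a point of [x, x + del]. Hence the
    approximation keeps both constants a and b exactly, which preserves a + b = 1. *)
Lemma C1_approximation (f : R -> R) (a b del : R) : (forall x, `|f x| <= a) ->
  (forall x y, `|f x - f y| <= b * `|x - y|) -> 0 < del -> continuous f ->
  exists f1 f1' : R -> R, [/\ forall x : R, is_derive x (1 : R) f1 (f1' x),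
    continuous f1', forall x, `|f1 x| <= a, forall x, `|f1' x| <= b &
    forall x, `|f1 x - f x| <= b * del].
Proof.
move=> fa fb del0 cf.
have b0 : 0 <= b by have := fb 1 0; rewrite subr0 normr1 mulr1; exact: le_trans.
have [Phi dPhi] := exists_primitive f a cf fa.
have dsh (x : R) : is_derive x (1 : R) (fun x => Phi (x + del)) (f (x + del)).
  have d1 := dPhi (x + del); apply: is_derive_eq; rewrite /GRing.scale /=; ring.
pose f1 x := del^-1 * (Phi (x + del) - Phi x).
pose f1' x := del^-1 * (f (x + del) - f x).
have mvt x : exists2 c, x <= c <= x + del & f1 x = f c.
  have xd : x <= x + del by rewrite lerDl ltW.
  have cP : {within `[x, x + del], continuous Phi}.
    apply: continuous_subspaceT => t.
    by apply/differentiable_continuous/derivable1_diffP; have [] := dPhi t.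
  have [c cx E] := @MVT_segment R Phi f x (x + del) xd (fun z _ => dPhi z) cP.
  exists c; first by move: cx; rewrite in_itv.
  by rewrite /f1 E; field; rewrite gt_eqF.
exists f1, f1'; split.
- move=> x; have d1 := dsh x; have d2 := dPhi x.
  by apply: is_derive_eq; rewrite /GRing.scale /= /f1'; ring.
- apply: continuous_mulR; first exact: continuous_cstR.
  apply: continuous_addR; last exact: continuous_oppR.
  apply: continuous_compR => //; apply: continuous_addR; [exact: continuous_idR|exact: continuous_cstR].
- by move=> x; have [c _ ->] := mvt x.
- move=> x; rewrite /f1' normrM gtr0_norm ?invr_gt0// mulrC ler_pdivrMr//.
  by apply: (le_trans (fb _ _)); rewrite addrAC subrr add0r gtr0_norm.
- move=> x; have [c /andP[xc cx] ->] := mvt x.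
  apply: (le_trans (fb _ _)); apply: ler_wpM2l => //.
  by rewrite ger0_norm ?subr_ge0// lerBlDr addrC.
Qed.

End smoothing.

(** * Real constants from the bounded-Lipschitz norm *)

Section bounded_lipschitz.
Context {R : realType}.
Implicit Types f : R -> R.

(** b is the Lipschitz seminorm, and a is 1 - b instead of the supremum, so that a + b = 1 holds
    exactly. *)
Lemma BL_norm_le1 f : (BL_norm f <= 1)%E -> exists a b : R,
  [/\ 0 <= b, a + b = 1, forall x, `|f x| <= a & forall x y, `|f x - f y| <= b * `|x - y|].
Proof.
rewrite /BL_norm; set S1 := ereal_sup _; set S2 := ereal_sup _ => h.
have S1x x : (`|f x|%:E <= S1)%E by apply: ereal_sup_ubound; exists x.
have S2x x y : x != y -> ((`|f x - f y| / `|x - y|)%:E <= S2)%E.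
  by move=> xy; apply: ereal_sup_ubound; exists (x, y).
have S1p : (0 <= S1)%E by apply: le_trans (S1x 0); rewrite lee_fin.
have S2p : (0 <= S2)%E.
  by apply: le_trans (S2x 1 0 _); rewrite ?oner_eq0// lee_fin divr_ge0.
have S11 : (S1 <= 1)%E by apply: le_trans h; rewrite leeDl.
have S21 : (S2 <= 1)%E by apply: le_trans h; rewrite leeDr.
have S1f : S1 \is a fin_num by rewrite ge0_fin_numE// (le_lt_trans S11)// ltry.
have S2f : S2 \is a fin_num by rewrite ge0_fin_numE// (le_lt_trans S21)// ltry.
move: h S1x S2x S1p S2p; rewrite -(fineK S1f) -(fineK S2f).
set a := fine S1; set b := fine S2; rewrite -EFinD !lee_fin => ab S1x S2x a0 b0.
exists (1 - b), b; split => //; first by rewrite subrK.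
- by move=> x; have := S1x x; rewrite lee_fin => /le_trans; apply; lra.
- move=> x y; have [->|xy] := eqVneq x y; first by rewrite !subrr normr0 mulr0.
  by have := S2x x y xy; rewrite lee_fin ler_pdivrMr// normr_gt0 subr_eq0.
Qed.

Lemma lipschitz_continuous_real f (b : R) : 0 <= b ->
  (forall x y, `|f x - f y| <= b * `|x - y|) -> continuous f.
Proof.
move=> b0 fb x; apply/cvgrPdist_le => e e0; near=> y.
(* The factor b + 1 is positive, so e can be divided by it even when b = 0. *)
apply: (le_trans (fb _ _)); apply: (@le_trans _ _ ((b + 1) * `|x - y|)).
  by apply: ler_wpM2r => //; rewrite lerDl.
rewrite mulrC -ler_pdivlMr; last by rewrite ltr_wpDl.
near: y; apply: cvgr_dist_le; first exact: cvg_id.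
by rewrite divr_gt0// ltr_wpDl.
Unshelve. all: by end_near. Qed.

End bounded_lipschitz.

(** * A lower bound on pi *)

Section pi_bound.
Context {R : realType}.

Lemma sin_le (x : R) : 0 <= x -> sin x <= x.
Proof.
move=> x0.
have cs : {within `[0, x], continuous (@sin R)}.
  by apply: continuous_subspaceT => t; exact: continuous_sin.
have [c _] := @MVT_segment R sin cos 0 x x0 (fun z _ => is_derive_sin z) cs.
by rewrite sin0 !subr0 => ->; rewrite ler_piMl// cos_le1.
Qed.

(** Two angle doublings starting from sin(3/8) <= 3/8 give cos(3/4) >= 23/32, then cos(3/2) > 0, so
    pi / 2 cannot lie below 3/2. *)
Lemma pi_ge3 : 3 <= pi :> R.
Proof.
have [//|pi3] := leP 3 (pi : R).
have cosE (y : R) : cos (2 * y) = 2 * cos y ^+ 2 - 1.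
  by rewrite mulr_natl cos_mulr2n -[cos y ^+ 2 *+ 2]mulr_natl.
have pi2 := @pi_ge2 R.
have s38 : sin (3 / 8 : R) ^+ 2 <= (3 / 8) ^+ 2.
  rewrite ler_sqr ?nnegrE//; first by apply: sin_le; lra.
  by apply: sin_ge0_pi; lra.
have c34 : 23 / 32 <= cos (3 / 4 : R).
  have := cosE (3 / 8); rewrite cos2sin2 (_ : 2 * (3 / 8) = 3 / 4); last by lra.
  lra.
have c32 : 0 < cos (3 / 2 : R).
  have := cosE (3 / 4); rewrite (_ : 2 * (3 / 4) = 3 / 2); last by lra.
  have : (23 / 32) ^+ 2 <= cos (3 / 4 : R) ^+ 2.
    by rewrite ler_sqr ?nnegrE//; lra.
  lra.
have : cos (3 / 2 : R) < cos (pi / 2 : R).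
  rewrite ltr_cos ?in_itv /=; lra.
rewrite cos_pihalf; lra.
Qed.

End pi_bound.

(** * Upper tail for a Lipschitz function *)

Section lipschitz_concentration.
Context {R : realType} {d n : nat} (hd : (2 <= d)%N) (hn : (1 <= n)%N).
Context (x : 'I_n -> 'rV[R]_d) (sigma : R) (hsigma : 0 < sigma).
Context (A B : R) (B0 : 0 < B).
Hypothesis hA : n%:R^-1 * \sum_(i < n) `|sigma ^- 2 * enorm (x i) ^+ 2 - d%:R| <= A.
Hypothesis hB : forall theta : 'rV[R]_d, @sphere R d theta ->
  n%:R^-1 * \sum_(i < n) dotv theta (x i) ^+ 2 <= B.
Context (P : probability (RdBorel R d) R) (hP : uniform_on_sphere P).
Let D : R := d%:R - 1.

Lemma measurable_gt_rV (phi : 'rV[R]_d -> R) (c : R) : continuous phi ->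
  measurable ([set u | (c < phi u)%R] : set (RdBorel R d)).
Proof.
move=> cphi; apply: sub_sigma_algebra.
by apply: (@open_comp _ _ phi [set z | c < z]) => // u _; exact: cphi.
Qed.

Lemma continuous_empirical (f : R -> R) : continuous f ->
  continuous (fun u => empirical_integral x u f).
Proof.
move=> cf; apply: continuous_mulR; first exact: continuous_cstR.
by apply: continuous_sumR => i; apply: continuous_compR => //; exact: continuous_dotv.
Qed.

Lemma empirical_integral_dist (f f1 : R -> R) (c : R) u : (forall t, `|f1 t - f t| <= c) ->
  `|empirical_integral x u f1 - empirical_integral x u f| <= c.
Proof.
move=> h; have n0 : 0 < n%:R :> R by rewrite ltr0n.
rewrite /empirical_integral -mulrBr -sumrB normrM gtr0_norm ?invr_gt0//.
rewrite mulrC ler_pdivrMr//; apply: (le_trans (ler_norm_sum _ _ _)).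
apply: (@le_trans _ _ (\sum_(i < n) c)); first exact: ler_sum.
by rewrite sumr_const card_ord mulr_natr.
Qed.

Lemma gauss_expect_dist (f f1 : R -> R) (a c : R) : continuous f -> continuous f1 ->
  (forall t, `|f t| <= a) -> (forall t, `|f1 t| <= a) -> (forall t, `|f1 t - f t| <= c) ->
  `|gauss_expect f1 sigma - gauss_expect f sigma| <= c.
Proof.
move=> cf cf1 fa f1a h.
have cs (k : R -> R) : continuous k -> continuous (fun z => k (sigma * z)).
  move=> ck; apply: continuous_compR => //.
  by apply: continuous_mulR; [exact: continuous_cstR|exact: continuous_idR].
rewrite (gauss_expectE f sigma a)// (gauss_expectE f1 sigma a)// -RintegralB//; last 2 first.
- exact: (integrable_mul_normal_pdf01 _ a (cs _ cf1)).
- exact: (integrable_mul_normal_pdf01 _ a (cs _ cf)).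
have -> : (fun z => f1 (sigma * z) * normal_pdf 0 1 z - f (sigma * z) * normal_pdf 0 1 z) =
    (fun z => (f1 (sigma * z) - f (sigma * z)) * normal_pdf (0 : R) 1 z).
  by apply/funext => z; rewrite mulrBl.
have := norm_Rintegral_normal_pdf01_le (fun z => f1 (sigma * z) - f (sigma * z)) c _ _
  setT measurableT.
rewrite Rintegral_normal_pdf01 mulr1; apply=> //.
by apply: continuous_addR; [exact: cs|apply: continuous_oppR; exact: cs].
Qed.

Lemma lipschitz_upper_tail (f : R -> R) (a b e1 eps : R) : 0 < b -> a + b = 1 ->
  (forall t, `|f t| <= a) -> (forall s t, `|f s - f t| <= b * `|s - t|) ->
  2 * (A + 2) / D <= e1 -> 9 / 4 * (Num.sqrt B / Num.sqrt D) < e1 -> e1 < eps ->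
  (P [set u | (eps < empirical_integral x u f - gauss_expect f sigma)%R] <=
   (expR (- (D * (e1 - 9 / 4 * (Num.sqrt B / Num.sqrt D)) ^+ 2 / (6 * B))))%:E)%E.
Proof.
move=> b0 ab fa fb h1 h2 h3.
have cf : continuous f by exact: (lipschitz_continuous_real _ _ (ltW b0)).
(* Smoothing moves the empirical integral and the Gaussian expectation by at most b del = (eps - e1)
   / 2 each, together the slack between e1 and eps. *)
pose del := (eps - e1) / (2 * b).
have del0 : 0 < del by rewrite divr_gt0 ?subr_gt0// mulr_gt0.
have [f1 [f1' [df1 cf1' f1a f1b ff1]]] := C1_approximation f a b del fa fb del0 cf.
have cf1 : continuous f1.
  by move=> t; apply/differentiable_continuous/derivable1_diffP; have [] := df1 t.
have := smooth_upper_tail hd hn x sigma hsigma A B B0 hA hB P hP f1 f1' a b b0 ab df1 cf1' f1a f1b e1 h1 h2.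
apply: le_trans; apply: le_measure; rewrite ?inE.
- apply: measurable_gt_rV; apply: continuous_addR; last exact: continuous_cstR.
  exact: continuous_empirical.
- apply: measurable_gt_rV; apply: continuous_addR; last exact: continuous_cstR.
  exact: continuous_empirical.
- move=> u /= hu.
  have d1 := empirical_integral_dist f f1 _ u ff1.
  have d2 := gauss_expect_dist f f1 a _ cf cf1 fa f1a ff1.
  have bd : b * del = (eps - e1) / 2 by rewrite /del; field; rewrite gt_eqF.
  move: d1 d2; rewrite bd !ler_norml; move: hu.
  set F1 := empirical_integral _ _ f1; set N1 := gauss_expect f1 _.
  set F0 := empirical_integral _ _ f; set N0 := gauss_expect f _.
  move=> hu /andP[k1 k2] /andP[k3 k4]; lra.
Qed.

End lipschitz_concentration.

(** * Numerical estimates and the two-sided bound *)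

Lemma second_moment_bound_gt0 (R : realType) (d n : nat) (x : 'I_n -> 'rV[R]_d) (B : R) :
  (1 <= n)%N -> (exists i, x i != 0) ->
  (forall theta : 'rV[R]_d, @sphere R d theta ->
    n%:R^-1 * \sum_(i < n) dotv theta (x i) ^+ 2 <= B) -> 0 < B.
Proof.
move=> hn [i xi0] hB.
have n0 : 0 < n%:R :> R by rewrite ltr0n.
have xx0 : 0 < dotv (x i) (x i).
  rewrite lt0r dotv_ge0 andbT; apply: contraNneq xi0 => xx; apply/eqP/rowP => j.
  rewrite mxE; apply/eqP; rewrite -sqrf_eq0 eq_le sqr_ge0 andbT -xx /dotv (bigD1 j)//=.
  by rewrite -expr2 lerDl sumr_ge0// => k _; rewrite -expr2 sqr_ge0.
have ex0 : 0 < enorm (x i) by rewrite sqrtr_gt0.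
have exx : enorm (x i) ^+ 2 = dotv (x i) (x i) by rewrite sqr_sqrtr// ltW.
(* In the direction of a nonzero x_i the second moment is positive. *)
pose th := (enorm (x i))^-1 *: x i.
have sth : @sphere R d th.
  by rewrite sphereE /= /th dotvZl dotvZr -exx; field; rewrite gt_eqF.
apply: lt_le_trans (hB th sth); rewrite mulr_gt0 ?invr_gt0//.
rewrite (bigD1 i)//=; apply: ltr_pwDl; last by rewrite sumr_ge0// => k _; rewrite sqr_ge0.
by rewrite exprn_gt0// /th dotvZl mulr_gt0// invr_gt0.
Qed.

(* The slack between [2 pi] and [6] pays for the factor 2 of the two-sided bound,
   and for the constant [9 / 4]. *)
Lemma two_sided_exp_le (R : realType) (s1 s0 : R) : 6 <= s1 -> 0 <= s0 -> 99 / 100 * s0 <= s1 ->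
  2 * expR (- ((s1 - 9 / 4) ^+ 2 / 6)) <= Num.sqrt (pi / 2) * expR (- (s0 ^+ 2 / 32)).
Proof.
move=> s6 s00 s01.
(* The summand 1 in the exponent yields a factor e >= 2, which pays for the two tails; sqrt(pi / 2)
   >= 1 is then enough. *)
have key : 1 + s0 ^+ 2 / 32 <= (s1 - 9 / 4) ^+ 2 / 6.
  have h : (99 / 100 * s0) ^+ 2 <= s1 ^+ 2.
    by rewrite ler_sqr ?nnegrE//; lra.
  have h2 : 0 <= (s1 - 6) * (s1 - 6) by rewrite -expr2 sqr_ge0.
  nra.
apply: (@le_trans _ _ (expR 1 * expR (- ((s1 - 9 / 4) ^+ 2 / 6)))).
  apply: ler_wpM2r; first exact: expR_ge0.
  by apply: le_trans (expR_ge1Dx 1); lra.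
rewrite -expRD; apply: (@le_trans _ _ (expR (- (s0 ^+ 2 / 32)))).
  by rewrite ler_expR; lra.
rewrite ler_peMl ?expR_ge0// -[X in X <= _]sqrtr1 ler_wsqrtr//.
by have := @pi_ge2 R; lra.
Qed.

Theorem theorem2 (R : realType) (d n : nat) (hd : (2 <= d)%N) (hn : (1 <= n)%N)
  (x : 'I_n -> 'rV[R]_d) (hx : exists i, x i != 0)
  (sigma : R) (hsigma : 0 < sigma)
  (hsig : n%:R^-1 * \sum_(i < n) enorm (x i) ^+ 2 = sigma ^+ 2 * d%:R)
  (A B : R)
  (hA : n%:R^-1 * \sum_(i < n) `|sigma ^- 2 * enorm (x i) ^+ 2 - d%:R| <= A)
  (hB : forall theta : 'rV[R]_d, @sphere R d theta ->
          n%:R^-1 * \sum_(i < n) dotv theta (x i) ^+ 2 <= B)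
  (f : R -> R) (hf : (BL_norm f <= 1)%E)
  (P : probability (RdBorel R d) R) (hP : uniform_on_sphere P)
  (eps : R)
  (heps : Num.max (2 * pi * Num.sqrt B / Num.sqrt (d%:R - 1))
                  (2 * (A + 2) / (d%:R - 1)) < eps) :
  (P [set theta | (eps < `|empirical_integral x theta f - gauss_expect f sigma|)%R]
   <= (Num.sqrt (pi / 2) * expR (- ((d%:R - 1) / (2 ^+ 5 * B)) * eps ^+ 2))%:E)%E.
Proof.
have B0 : 0 < B := second_moment_bound_gt0 _ _ _ _ _ hn hx hB.
set N := gauss_expect f sigma.
set F := fun u => empirical_integral x u f.
have [a [b [b0 ab fa fb]]] := BL_norm_le1 f hf.
(* The Chernoff parameter divides by b. When b = 0, f is constant and the event is empty. *)
have [bE|bn0] := eqVneq b 0.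
  have fcst t : f t = f 0.
    apply/eqP; rewrite -subr_eq0 -normr_eq0 eq_le normr_ge0 andbT.
    by have := fb t 0; rewrite bE mul0r.
  have n0 : n%:R != 0 :> R by rewrite pnatr_eq0 -lt0n.
  have FE u : F u = f 0.
    rewrite /F /empirical_integral; under eq_bigr do rewrite fcst.
    by rewrite sumr_const card_ord -[f 0 *+ n]mulr_natl mulrA mulVf// mul1r.
  have NE : N = f 0.
    rewrite /N /gauss_expect; under eq_Rintegral do rewrite fcst.
    rewrite Rintegral_cst// (_ : fine _ = 1) ?mulr1//.
    by transitivity (fine (1%E : \bar R)); [congr fine; exact: (integral_normal_pdf 0 1)|].
  have eps0 : 0 < eps.
    apply: le_lt_trans heps; rewrite le_max; apply/orP; left.
    by rewrite divr_ge0 ?sqrtr_ge0// mulr_ge0 ?sqrtr_ge0// mulr_ge0 ?pi_ge0.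
  have -> : [set theta | (eps < `|empirical_integral x theta f - N|)%R] = set0.
    apply/seteqP; split => // u /=; rewrite -/(F u) FE NE subrr normr0.
    by rewrite ltNge (ltW eps0).
  by rewrite measure0 lee_fin mulr_ge0 ?sqrtr_ge0 ?expR_ge0.
have {}b0 : 0 < b by rewrite lt0r bn0.
set D : R := d%:R - 1 in heps *.
have D1 : 1 <= D by rewrite /D lerBrDr (_ : 1 + 1 = 2%:R)// ler_nat.
have D0 : 0 < D by exact: lt_le_trans D1.
have sD0 : 0 < Num.sqrt D by rewrite sqrtr_gt0.
have sB0 : 0 < Num.sqrt B by rewrite sqrtr_gt0.
set q := Num.sqrt B / Num.sqrt D.
have q0 : 0 < q by rewrite divr_gt0.
set thr := Num.max _ _ in heps.
have thr1 : 2 * pi * q <= thr by rewrite /thr le_max mulrA lexx.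
have thr2 : 2 * (A + 2) / D <= thr by rewrite /thr le_max lexx orbT.
have pi3 := @pi_ge3 R.
have thr3 : 6 * q <= thr.
  by apply: le_trans thr1; apply: ler_wpM2r; [exact: ltW|lra].
have thr0 : 0 < thr by apply: lt_le_trans thr3; rewrite mulr_gt0.
(* The level at which the smoothed function is treated: strictly below eps to leave room for
   smoothing, above the threshold, and within 1 percent of eps as [two_sided_exp_le] requires. *)
pose e1 := Num.max (99 / 100 * eps) ((thr + eps) / 2).
have e1eps : e1 < eps by rewrite /e1 gt_max; lra.
have e1thr : thr <= e1 by rewrite /e1 le_max; apply/orP; right; lra.
have e1eps2 : 99 / 100 * eps <= e1 by rewrite /e1 le_max lexx.
have q9 : 9 / 4 * q < e1.
  by apply: lt_le_trans e1thr; apply: lt_le_trans thr3; rewrite ltr_pM2r//; lra.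
(* Stated for any k with the same constants, so that it serves f and - f. Since q^2 = B / D, the
   exponent depends on e1 / q only. *)
have tail (k : R -> R) : (forall t, `|k t| <= a) ->
    (forall s t, `|k s - k t| <= b * `|s - t|) ->
    (P [set u | (eps < empirical_integral x u k - gauss_expect k sigma)%R] <=
     (expR (- ((e1 / q - 9 / 4) ^+ 2 / 6)))%:E)%E.
  move=> ka kb.
  have := lipschitz_upper_tail hd hn x sigma hsigma A B B0 hA hB P hP k a b e1 eps
    b0 ab ka kb (le_trans thr2 e1thr) q9 e1eps.
  rewrite -/D -/q (_ : D * (e1 - 9 / 4 * q) ^+ 2 / (6 * B) = (e1 / q - 9 / 4) ^+ 2 / 6)//.
  have -> : (e1 / q - 9 / 4) = (e1 - 9 / 4 * q) / q by field; rewrite gt_eqF.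
  rewrite expr_div_n /q expr_div_n !sqr_sqrtr ?ltW//.
  by field; rewrite !gt_eqF.
have cf : continuous f by exact: (lipschitz_continuous_real _ _ (ltW b0)).
have cF : continuous F by exact: continuous_empirical.
pose f2 t := - f t.
have tail1 := tail f fa fb.
have tail2 : (P [set u | (eps < - (F u - N))%R] <=
     (expR (- ((e1 / q - 9 / 4) ^+ 2 / 6)))%:E)%E.
  have f2a t : `|f2 t| <= a by rewrite normrN.
  have f2b s t : `|f2 s - f2 t| <= b * `|s - t|.
    by rewrite /f2 -opprD normrN.
  have cf2 : continuous f2 by exact: continuous_oppR.
  have := tail f2 f2a f2b.
  have -> : gauss_expect f2 sigma = - N.
    rewrite /N (gauss_expectE f2 sigma a)// (gauss_expectE f sigma a)//.
    rewrite -mulN1r -RintegralZl//; last first.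
      apply: (integrable_mul_normal_pdf01 _ a) => //.
      by apply: continuous_compR => //; apply: continuous_mulR; [exact: continuous_cstR|exact: continuous_idR].
    by apply: eq_Rintegral => z _; rewrite /f2; ring.
  have f2E u : empirical_integral x u f2 = - F u.
    by rewrite /F /empirical_integral /f2 sumrN mulrN.
  rewrite (_ : [set u | _] = [set u | (eps < - (F u - N))%R])//.
  by apply/seteqP; split=> u /=; rewrite f2E opprK opprB addrC.
have -> : [set theta | (eps < `|empirical_integral x theta f - N|)%R] =
    [set u | (eps < F u - N)%R] `|` [set u | (eps < - (F u - N))%R].
  by apply/seteqP; split=> u /=; rewrite -/(F u) ltr_normr; [move/orP|move=> /orP].
have cFN : continuous (fun u => F u - N).
  by apply: continuous_addR => //; exact: continuous_cstR.
apply: (le_trans (measureU2 _ _ _)).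
- exact: measurable_gt_rV.
- by apply: measurable_gt_rV; exact: continuous_oppR.
apply: (le_trans (leeD tail1 tail2)); rewrite -EFinD lee_fin.
have s0E : D / (2 ^+ 5 * B) * eps ^+ 2 = (eps / q) ^+ 2 / 32.
  rewrite [in RHS]expr_div_n /q expr_div_n !sqr_sqrtr ?ltW//.
  by field; rewrite !gt_eqF.
rewrite mulNr s0E.
apply: (@le_trans _ _ (2 * expR (- ((e1 / q - 9 / 4) ^+ 2 / 6)))).
  by move: (expR _) => E; rewrite (_ : 2 * E = E + E)//; ring.
apply: two_sided_exp_le.
- by rewrite ler_pdivlMr// (le_trans thr3).
- by rewrite divr_ge0 ?ltW// (lt_trans thr0).
- by rewrite mulrA ler_pM2r// invr_gt0.
Qed.
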